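(* Let $c_*^{V}$ denote the least possible absolute constant $c$ such that $$\mathsf P(V_n\ge x)\le c\,\mathsf P(Z\ge x)\qquad\text{for all }x\in\mathbb R,$$ for all $n\in\{1,2,\dots\}$ and all real random variables $X_1,\dots,X_n$ satisfying the orthant symmetry condition, where $$V_n:=\frac{X_1+\dots+X_n}{\sqrt{X_1^2+\dots+X_n^2}}.$$ Then $$c_*^{V}\in[c_1,c_2],$$ where $$c_1:=\frac1{4\overline{\Phi}(\sqrt2)}\quad\text{and}\quad c_2:=c_1\cdot\Big(1+\tfrac1{250}\big(1+r(\sqrt3\,)\big)\Big);$$ here, numerically, $[c_1,c_2]\approx[3.18,3.22]$ and $c_2\approx c_1\cdot1.01$.
   Context: Random variables $X_1,\dots,X_n$ (on a common probability space) satisfy the orthant symmetry condition if the joint distribution of $\delta_1X_1,\dots,\delta_nX_n$ is the same for any choice of signs $\delta_1,\dots,\delta_n\in\{1,-1\}$. The convention $V_n:=0$ is used on the event $X_1=\dots=X_n=0$. $Z\sim N(0,1)$ is a standard normal random variable. $\varphi(x):=e^{-x^2/2}/\sqrt{2\pi}$ is its density, $\overline{\Phi}(x):=\mathsf P(Z\ge x)=\int_x^\infty\varphi(u)\,du$ its tail function, and $r:=\varphi/\overline{\Phi}$ the inverse Mills ratio. *)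

(* Defs.v *)
From HB Require Import structures.
From mathcomp Require Import all_boot all_order all_algebra.
From mathcomp Require Import all_classical all_reals all_analysis.

Set Implicit Arguments.
Unset Strict Implicit.
Unset Printing Implicit Defensive.

Import Order.TTheory GRing.Theory Num.Theory.
Import numFieldNormedType.Exports.

Local Open Scope classical_set_scope.
Local Open Scope ring_scope.

Definition is_sign (R : realType) (n : nat) (delta : 'I_n -> R) : Prop :=
  forall i, delta i = 1 \/ delta i = -1.

Definition signed_vector (R : realType) (d : measure_display)
    (T : measurableType d) (P : probability T R) (n : nat)
    (X : 'I_n -> {RV P >-> R})
    (delta : 'I_n -> R) (t : T) : n.-tuple R :=
  [tuple delta i * X i t | i < n].

(* [n.-tuple R] carries the product sigma-algebra. Two laws are compared on
   measurable sets only, since [pushforward] is defined on arbitrary sets. *)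
Definition orthant_symmetric (R : realType) (d : measure_display)
    (T : measurableType d) (P : probability T R) (n : nat)
    (X : 'I_n -> {RV P >-> R}) : Prop :=
  forall delta delta' : 'I_n -> R, is_sign delta -> is_sign delta' ->
  forall A : set (n.-tuple R), measurable A ->
    pushforward P (signed_vector X delta) A =
    pushforward P (signed_vector X delta') A.

(* Where all the [X i] vanish this is [0 / 0 = 0], as division by 0 is 0. *)
Definition self_normalized_sum (R : realType) (d : measure_display)
    (T : measurableType d) (P : probability T R) (n : nat)
    (X : 'I_n -> {RV P >-> R}) (t : T) : R :=
  (\sum_(i < n) X i t) / Num.sqrt (\sum_(i < n) X i t ^+ 2).

Definition phi (R : realType) (x : R) : R :=
  expR (- (x ^+ 2) / 2) / Num.sqrt (2 * pi).

Definition Phibar (R : realType) (x : R) : R :=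
  fine (normal_prob (0 : R) 1 `[x, +oo[).

Definition inv_mills (R : realType) (x : R) : R := phi x / Phibar x.

Lemma phiE (R : realType) (x : R) : normal_pdf 0 1 x = phi x.
Proof.
rewrite normal_pdfE ?oner_neq0// /normal_peak /normal_fun /phi mulrC.
by rewrite expr1n mul1r subr0 mulr_natl.
Qed.

Lemma PhibarE (R : realType) (x : R) :
  Phibar x = \int[lebesgue_measure]_(u in `[x, +oo[) phi u.
Proof.
rewrite /Phibar /normal_prob /Rintegral; congr fine.
by apply: eq_integral => u _; rewrite phiE.
Qed.

Lemma Phibar_fineK (R : realType) (x : R) :
  (Phibar x)%:E = normal_prob (0 : R) 1 `[x, +oo[.
Proof. by rewrite /Phibar fineK// fin_num_measure. Qed.

Definition tail_constants (R : realType) : set R :=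
  [set c | forall (d : measure_display) (T : measurableType d)
             (P : probability T R) (n : nat) (X : 'I_n -> {RV P >-> R}),
           (1 <= n)%N -> orthant_symmetric X ->
           forall x : R,
             (P [set t | (x <= self_normalized_sum X t)%R]
                <= (c * Phibar x)%:E)%E].

Arguments tail_constants R : clear implicits.

Definition c1 (R : realType) : R := 1 / (4 * Phibar (Num.sqrt 2)).

Definition c2 (R : realType) : R :=
  c1 R * (1 + 1 / 250 * (1 + inv_mills (Num.sqrt 3))).

(* Main.v *)
Require Import Defs.
From HB Require Import structures.
From mathcomp Require Import all_boot all_order all_algebra.
From mathcomp Require Import all_classical all_reals all_analysis.
From mathcomp Require Import measurable_realfun normal_distribution.
From mathcomp Require Import ring lra.

(** The lower bound comes from two independent fair signs at the level
    [sqrt 2]: their ratio equals [sqrt 2] exactly when both signs are [+1],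
    which has probability [1/4 = c1 * Phibar (sqrt 2)] ([c1_lower_bound]).
    Each instance of the inequality bounds the constant from below by a ratio
    with positive denominator [Phibar x], so the infimum of the admissible
    constants is itself admissible ([inf_tail_constant]).

    For the upper bound, orthant symmetry lets one average over all sign
    patterns.  Pointwise this turns the event into the tail of a Rademacher
    sum whose coefficients [s] are the observed values ([self_normalized_le]),
    so it is enough to show that the probability that [sum_i eps_i s_i] is at
    least [x |s|] (here [rtail s (x |s|)]) is at most [c2 * Phibar x]
    ([rtail_le_gauss]).

    This goes by induction on the number of coefficients.  Conditioning on one
    sign, with normalized coefficient [t], replaces the level [x] by the two
    levels [A = (x - t) / sqrt (1 - t^2)] and [B = (x + t) / sqrt (1 - t^2)]
    for the shorter sum, so the induction step for a bound [f] is
    [f A + f B <= 2 * f x].  Since [phi A = phi B * exp (2 x t / (1 - t^2))],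
    the derivative in [t] of the left-hand side is explicit, and the step
    reduces to comparing that exponential with
    [(1 + x t) / (1 - x t) = exp (2 artanh (x t))] ([step_nincr]).

    - For [x >= sqrt 3] the comparison holds termwise in the power series,
      and [f = Phibar] satisfies the step for every [t] ([Phibar_step]).
    - For [x <= sqrt 2] no induction is needed: Chebyshev's inequality for
      symmetric sums gives [1 / (2 x^2)], which [c2 * Phibar x] dominates
      down to [x = 1] ([chebyshev_le_Phibar]).  Below [1] the trivial bounds
      [1/2] and [1] are enough.
    - For [sqrt 2 <= x <= sqrt 3] the step fails for [Phibar] already to
      leading order in [t].  There [Phibar] is replaced by [mid_bound], whose
      derivative [- mid_weight * phi] has a weight that decreases linearly as
      one moves left from [sqrt 3].  The level [B] then counts a little more
      than the level [A], which pays for the loss when [t <= 103/250]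
      ([mid_step_below], [mid_step_above]).  If instead every normalized
      coefficient exceeds [103/250], there are at most five of them and only
      the sign pattern that makes all terms positive can exceed [sqrt 2], so
      the probability is at most [1/8] ([rtail_le_eighth]).

    The induction in the middle range needs Chebyshev's bound to lie below
    [c1 * mid_bound] on the levels [A] that fall under [sqrt 2]
    ([chebyshev_le_mid_bound]).  At [sqrt 2] itself Chebyshev gives
    [1/4 = c1 * Phibar (sqrt 2)], so [mid_bound (sqrt 2)] must be at least
    [Phibar (sqrt 2)]: the factor [c2 / c1] makes up for the reduced weight
    ([Phibar_sqrt2_le_mid_bound]). *)

Set Implicit Arguments.
Unset Strict Implicit.
Unset Printing Implicit Defensive.

Import Order.TTheory GRing.Theory Num.Theory.
Import numFieldNormedType.Exports.
Local Open Scope classical_set_scope.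
Local Open Scope ring_scope.

(** * Differentiation rules for explicit functions *)
Section Calculus.
Context {R : realType}.
Implicit Types (f g : R -> R) (x a b : R).

Lemma deriv1_cst (c x : R) : is_derive x 1 (fun=> c) 0.
Proof. exact: is_derive_cst. Qed.

Lemma deriv1_id x : is_derive x 1 (fun y : R => y) 1.
Proof. exact: is_derive_id. Qed.

Lemma deriv1_add f g x (df dg : R) : is_derive x 1 f df -> is_derive x 1 g dg ->
  is_derive x 1 (fun y => f y + g y) (df + dg).
Proof. by move=> ? ?; exact: is_deriveD. Qed.

Lemma deriv1_opp f x (df : R) : is_derive x 1 f df ->
  is_derive x 1 (fun y => - f y) (- df).
Proof. by move=> ?; exact: is_deriveN. Qed.

Lemma deriv1_mul f g x (df dg : R) : is_derive x 1 f df -> is_derive x 1 g dg ->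
  is_derive x 1 (fun y => f y * g y) (df * g x + f x * dg).
Proof.
move=> hf hg; apply: (is_derive_eq (is_deriveM hf hg)).
by rewrite /GRing.scale/= addrC (mulrC (g x)).
Qed.

Lemma deriv1_exp f n x (df : R) : is_derive x 1 f df ->
  is_derive x 1 (fun y => f y ^+ n) (n%:R * f x ^+ n.-1 * df).
Proof.
move=> hf; rewrite (_ : (fun y => _) = f ^+ n); last first.
  by apply/funext => y; rewrite exprfctE.
apply: (is_derive_eq (is_deriveX n hf)).
by rewrite /GRing.scale/= mulr_natl.
Qed.

Lemma deriv1_inv f x (df : R) : f x != 0 -> is_derive x 1 f df ->
  is_derive x 1 (fun y => (f y)^-1) (- df / f x ^+ 2).
Proof.
move=> fx0 hf; apply: (is_derive_eq (is_deriveV fx0 hf)).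
by rewrite /GRing.scale/= mulNr mulrC mulNr.
Qed.

Lemma deriv1_comp f g x (df dg : R) : is_derive (g x) 1 f df ->
  is_derive x 1 g dg -> is_derive x 1 (fun y => f (g y)) (df * dg).
Proof.
by move=> hf hg; exact: is_derive1_comp.
Qed.

Lemma deriv1_sqrt f x (df : R) : 0 < f x -> is_derive x 1 f df ->
  is_derive x 1 (fun y => Num.sqrt (f y)) ((2 * Num.sqrt (f x))^-1 * df).
Proof. by move=> fx ?; apply: deriv1_comp; exact: is_derive1_sqrt. Qed.

Lemma deriv1_ln f x (df : R) : 0 < f x -> is_derive x 1 f df ->
  is_derive x 1 (fun y => ln (f y)) ((f x)^-1 * df).
Proof. by move=> fx ?; apply: deriv1_comp; exact: is_derive1_ln. Qed.

Lemma le_of_derive_le0 f (df : R -> R) a b : a <= b ->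
  (forall x, a <= x <= b -> is_derive x 1 f (df x)) ->
  (forall x, a <= x <= b -> df x <= 0) -> f b <= f a.
Proof.
move=> ab fdf df0.
have fab x : x \in `]a, b[%R -> is_derive x 1 f (df x).
  by rewrite in_itv/= => /andP[ax xb]; apply: fdf; rewrite !ltW.
apply: (@ler0_derive1_le_cc R f a b) => //.
- by move=> x /fab dfx; exact: ex_derive.
- move=> x xab; rewrite derive1E; have dfx := fab _ xab; rewrite derive_val.
  by apply: df0; move: xab; rewrite in_itv/= => /andP[ax xb]; rewrite !ltW.
- apply: continuous_in_subspaceT => x; rewrite inE/= in_itv/= => /fdf[dfx _].
  by apply: differentiable_continuous; exact/derivable1_diffP.
- by rewrite in_itv/= lexx ab.
- by rewrite in_itv/= lexx ab.
Qed.

End Calculus.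

(** Reads a derivative off the shape of an explicit lambda term; the value of
    the derivative may be an existential variable.  Facts about other
    functions are taken from the context, and the side conditions of inverse,
    square root and logarithm are left as goals. *)
Ltac der := first
  [ eassumption
  | match goal with
    | |- is_derive _ _ (fun y => y) _ => exact: deriv1_id
    | |- is_derive _ _ (fun _ => ?c) _ => exact: (deriv1_cst c)
    | |- is_derive _ _ (fun y => @?f y + @?g y) _ => eapply (@deriv1_add _ f g); der
    | |- is_derive _ _ (fun y => - @?f y) _ => eapply (@deriv1_opp _ f); der
    | |- is_derive _ _ (fun y => @?f y * @?g y) _ => eapply (@deriv1_mul _ f g); der
    | |- is_derive _ _ (fun y => @?f y ^+ ?n) _ => eapply (@deriv1_exp _ f n); der
    | |- is_derive _ _ (fun y => (@?f y)^-1) _ => eapply (@deriv1_inv _ f); [|der]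
    | |- is_derive _ _ (fun y => Num.sqrt (@?f y)) _ => eapply (@deriv1_sqrt _ f); [|der]
    | |- is_derive _ _ (fun y => ln (@?f y)) _ => eapply (@deriv1_ln _ f); [|der]
    | |- is_derive _ _ (fun y => expR (@?f y)) _ =>
        eapply (@deriv1_comp _ expR f); [exact: is_derive_expR|der]
    | |- is_derive _ _ (fun y => ?F (@?f y)) _ => eapply (@deriv1_comp _ F f); [|der]
    end
  | idtac ].

(** * The standard normal density and tail *)
Section Gauss.
Context {R : realType}.
Implicit Types x y : R.
Local Notation mu := (@lebesgue_measure R).

Lemma phi_gt0 x : 0 < phi x.
Proof. by rewrite divr_gt0 ?expR_gt0// sqrtr_gt0 mulr_gt0 ?pi_gt0//. Qed.

Lemma phi_derive x : is_derive x 1 (@phi R) (- x * phi x).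
Proof.
rewrite /phi; eapply is_derive_eq; [by der|rewrite /= expr1].
by set c := (Num.sqrt _)^-1; set e := expR _; field.
Qed.

Lemma phi_continuous : continuous (@phi R).
Proof.
move=> x; have [dphi _] := phi_derive x.
by apply: differentiable_continuous; exact/derivable1_diffP.
Qed.

Lemma phi_even x : phi (- x) = phi x.
Proof. by rewrite /phi sqrrN. Qed.

Lemma normal_pdf01E : normal_pdf 0 1 = @phi R.
Proof. by apply/funext => u; rewrite phiE. Qed.

Lemma phi_integrable : mu.-integrable setT (EFin \o @phi R).
Proof.
by have := @integrable_normal_pdf R 0 1; rewrite normal_pdf01E.
Qed.

(** The distribution function, for which the fundamental theorem of calculus
    applies directly on a half-line unbounded on the left. *)
Definition Phi x : R := \int[mu]_(u in `]-oo, x]) phi u.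

Lemma Phi_derive x : is_derive x 1 Phi (phi x).
Proof.
have [||||d1 d2] := @continuous_FTC1 R (@phi R) -oo%O x (x + 1).
- by rewrite ltrDl.
- by apply: (integrableS _ _ (subsetT _)) phi_integrable.
- by rewrite ltNyr.
- exact: phi_continuous.
by split; [exact: d1|rewrite -derive1E; exact: d2].
Qed.

Lemma Phibar_Phi x : Phibar x = 1 - Phi x.
Proof.
have -> : Phi x = fine (normal_prob (0:R) 1 `]-oo, x]).
  by rewrite /Phi /Rintegral /normal_prob; under eq_integral do rewrite -phiE.
apply/EFin_inj; rewrite Phibar_fineK EFinB fineK ?fin_num_measure//.
have -> : `[x, +oo[%classic = ~` (`]-oo, x[ : set R).
  by rewrite setCitvl.
rewrite probability_setC//; congr (_ - _)%E.
rewrite /normal_prob -[RHS]integral_itv_bndo_bndc//.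
apply/measurable_EFinP; apply: measurable_funTS.
exact: measurable_normal_pdf.
Qed.

Lemma Phibar_derive x : is_derive x 1 (@Phibar R) (- phi x).
Proof.
rewrite (_ : @Phibar R = fun x => 1 - Phi x); last first.
  by apply/funext => ?; rewrite Phibar_Phi.
have ? := Phi_derive x.
by eapply is_derive_eq; [by der|rewrite add0r].
Qed.
End Gauss.

Section GaussTail.
Context {R : realType}.
Implicit Types x y : R.
Local Notation mu := (@lebesgue_measure R).

Lemma ge0_of_derive (f df : R -> R) : f 0 = 0 ->
  (forall x, 0 <= x -> is_derive x 1 f (df x)) ->
  (forall x, 0 <= x -> 0 <= df x) -> forall x, 0 <= x -> 0 <= f x.
Proof.
move=> f0 fdf df0 x x0.
have := @le_of_derive_le0 R (fun y => - f y) (fun y => - df y) 0 x x0.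
rewrite f0 oppr0 oppr_le0; apply.
- by move=> y /andP[y0 _]; have ? := fdf y y0; der.
- by move=> y /andP[y0 _]; rewrite oppr_le0 df0.
Qed.

Lemma Phibar_anti x y : x <= y -> Phibar y <= Phibar x.
Proof.
move=> xy; apply: (@le_of_derive_le0 R (@Phibar R) (fun u => - phi u)) => //.
- by move=> u _; exact: Phibar_derive.
- by move=> u _; rewrite oppr_le0 ltW// phi_gt0.
Qed.

Lemma Phibar_ge0 x : 0 <= Phibar x.
Proof. by rewrite fine_ge0. Qed.

Lemma Phibar0 : Phibar 0 = 1 / 2 :> R.
Proof.
have : (\int[mu]_u (phi u)%:E)%E = 1%E :> \bar R.
  by rewrite -(@integral_normal_pdf R 0 1) normal_pdf01E.
rewrite ge0_symfun_integralT//=; last 3 first.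
- by move=> u; exact: ltW (phi_gt0 u).
- exact: phi_continuous.
- by move=> u; rewrite /= phi_even.
rewrite (_ : [set x : R | _] = `[0, +oo[%classic); last first.
  by apply/seteqP; split => u/=; rewrite in_itv/= andbT.
have -> : (\int[mu]_(u in `[0%R, +oo[) (phi u)%:E)%E = (Phibar 0)%:E :> \bar R.
  by rewrite Phibar_fineK /normal_prob normal_pdf01E.
by rewrite -EFinM => -[]; lra.
Qed.

Lemma Phibar_vanishes (e : R) : 0 < e -> exists M : R,
  forall x, M <= x -> Phibar x <= e.
Proof.
move=> e0.
pose F (n : nat) : set R := `[n%:R, +oo[%classic.
have : normal_prob (0:R) 1 (F n) @[n --> \oo] --> normal_prob (0:R) 1 (\bigcap_n F n).
  apply: nonincreasing_cvg_mu => //.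
  - by rewrite -ge0_fin_numE// fin_num_measure//; exact: measurable_itv.
  - by move=> n; exact: measurable_itv.
  - by apply: bigcapT_measurable => n; exact: measurable_itv.
  - move=> m n mn; apply/subsetPset => u; rewrite /F/= !in_itv/= !andbT.
    by apply: le_trans; rewrite ler_nat.
have -> : \bigcap_n F n = set0.
  rewrite -subset0 => u; have un := archi_boundP (normr_ge0 u).
  move=> /(_ (Num.bound `|u|) I); rewrite /F/= in_itv/= andbT => /(lt_le_trans un).
  by rewrite ltNge ler_norm.
rewrite measure0 => /fine_cvgP[_ /cvgr0Pnorm_le /(_ _ e0)[N _ hN]].
exists N%:R => x Nx; apply: le_trans (Phibar_anti Nx) _.
have := hN N (leqnn N); rewrite /= ger0_norm//.
exact: fine_ge0.
Qed.
End GaussTail.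

(** * Rational bounds for the constants *)
Section Numerics.
Context {R : realType}.
Implicit Types x y v : R.

Definition exp_taylor (n : nat) v : R := \sum_(k < n) (- v) ^+ k / k`!%:R.

Lemma exp_taylor_derive n v :
  is_derive v 1 (exp_taylor n.+1) (- exp_taylor n v).
Proof.
elim: n => [|n ih].
  rewrite /exp_taylor big_ord0 oppr0 (_ : (fun _ => _) = fun=> 1); first by der.
  by apply/funext => y; rewrite big_ord1 expr0 fact0 divr1.
rewrite (_ : exp_taylor n.+2 =
    fun y => exp_taylor n.+1 y + (- y) ^+ n.+1 / n.+1`!%:R); last first.
  by apply/funext => y; rewrite /exp_taylor big_ord_recr.
eapply is_derive_eq; first by der.
rewrite [exp_taylor n.+1 v]/exp_taylor big_ord_recr/= -/(exp_taylor n v).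
rewrite factS natrM.
have : n`!%:R != 0 :> R by rewrite pnatr_eq0 -lt0n fact_gt0.
have : n.+1%:R != 0 :> R by [].
by move=> ? ?; field; apply/andP.
Qed.

(** The derivative of [exp (- v) - exp_taylor n.+1 v] is minus the same
    difference for [n], and it vanishes at [0], so the signs alternate by
    induction. *)
Lemma exp_taylor_alternate n v : 0 <= v ->
  0 <= (-1) ^+ n * (expR (- v) - exp_taylor n v).
Proof.
elim: n v => [|n ih] v v0.
  by rewrite expr0 mul1r /exp_taylor big_ord0 subr0 expR_ge0.
have d y : 0 <= y -> is_derive y 1
    (fun v => (-1) ^+ n.+1 * (expR (- v) - exp_taylor n.+1 v))
    ((-1) ^+ n * (expR (- y) - exp_taylor n y)).
  move=> _; have ? := exp_taylor_derive n y.
  by eapply is_derive_eq; [by der|rewrite exprS; ring].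
apply: (ge0_of_derive _ d ih v0).
rewrite /exp_taylor oppr0 expR0 big_ord_recl expr0 fact0 divr1 big1 ?addr0.
  by rewrite subrr mulr0.
by move=> i _; rewrite expr0n/= mul0r.
Qed.

Lemma factorialsE : ((0`! = 1)%N * (1`! = 1)%N * (2`! = 2)%N * (3`! = 6)%N) *
  ((4`! = 24)%N * (5`! = 120)%N * (6`! = 720)%N * (7`! = 5040)%N).
Proof. by []. Qed.

Lemma exp_taylor7 v : 0 <= v -> expR (- v) <=
  1 - v + v ^+ 2 / 2 - v ^+ 3 / 6 + v ^+ 4 / 24 - v ^+ 5 / 120 + v ^+ 6 / 720.
Proof.
move=> /(exp_taylor_alternate 7).
rewrite /exp_taylor !big_ord_recr big_ord0 /= !factorialsE.
lra.
Qed.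

Lemma exp_taylor8 v : 0 <= v ->
  1 - v + v ^+ 2 / 2 - v ^+ 3 / 6 + v ^+ 4 / 24 - v ^+ 5 / 120 + v ^+ 6 / 720
    - v ^+ 7 / 5040 <= expR (- v).
Proof.
move=> /(exp_taylor_alternate 8).
rewrite /exp_taylor !big_ord_recr big_ord0 /= !factorialsE.
lra.
Qed.

(** Integrating [cos <= 1] from [0] again and again yields the alternating
    Taylor bounds of [sin] and [cos] in turn. *)
Lemma sin_bounds x : 0 <= x ->
  x - x ^+ 3 / 6 + x ^+ 5 / 120 - x ^+ 7 / 5040 <= sin x
    <= x - x ^+ 3 / 6 + x ^+ 5 / 120.
Proof.
pose D (f df : R -> R) := forall z : R, 0 <= z -> is_derive z 1 f (df z).
have pos f df : D f df -> f 0 = 0 -> (forall z : R, 0 <= z -> 0 <= df z) ->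
    forall z : R, 0 <= z -> 0 <= f z.
  by move=> fdf f0; exact: ge0_of_derive.
move=> x0.
have s0 : forall y : R, 0 <= y -> 0 <= 1 - cos y by move=> y _; rewrite subr_ge0 cos_le1.
have s1 : forall y : R, 0 <= y -> 0 <= y - sin y.
  apply: (pos _ (fun y => 1 - cos y) _ _ s0).
    by move=> z _; eapply is_derive_eq; [der; exact: is_derive_sin|rewrite /=; field].
  by rewrite sin0; ring.
have s2 : forall y : R, 0 <= y -> 0 <= cos y - (1 - y ^+ 2 / 2).
  apply: (pos _ (fun y => y - sin y) _ _ s1).
    by move=> z _; eapply is_derive_eq; [der; exact: is_derive_cos|rewrite /=; field].
  by rewrite cos0; ring.
have s3 : forall y : R, 0 <= y -> 0 <= sin y - (y - y ^+ 3 / 6).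
  apply: (pos _ (fun y => cos y - (1 - y ^+ 2 / 2)) _ _ s2).
    by move=> z _; eapply is_derive_eq; [der; exact: is_derive_sin|rewrite /=; field].
  by rewrite sin0; ring.
have s4 : forall y : R, 0 <= y -> 0 <= 1 - y ^+ 2 / 2 + y ^+ 4 / 24 - cos y.
  apply: (pos _ (fun y => sin y - (y - y ^+ 3 / 6)) _ _ s3).
    by move=> z _; eapply is_derive_eq; [der; exact: is_derive_cos|rewrite /=; field].
  by rewrite cos0; ring.
have s5 : forall y : R, 0 <= y -> 0 <= y - y ^+ 3 / 6 + y ^+ 5 / 120 - sin y.
  apply: (pos _ (fun y => 1 - y ^+ 2 / 2 + y ^+ 4 / 24 - cos y) _ _ s4).
    by move=> z _; eapply is_derive_eq; [der; exact: is_derive_sin|rewrite /=; field].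
  by rewrite sin0; ring.
have s6 : forall y : R, 0 <= y -> 0 <= cos y - (1 - y ^+ 2 / 2 + y ^+ 4 / 24 - y ^+ 6 / 720).
  apply: (pos _ (fun y => y - y ^+ 3 / 6 + y ^+ 5 / 120 - sin y) _ _ s5).
    by move=> z _; eapply is_derive_eq; [der; exact: is_derive_cos|rewrite /=; field].
  by rewrite cos0; ring.
have s7 : forall y : R, 0 <= y -> 0 <= sin y - (y - y ^+ 3 / 6 + y ^+ 5 / 120 - y ^+ 7 / 5040).
  apply: (pos _ (fun y => cos y - (1 - y ^+ 2 / 2 + y ^+ 4 / 24 - y ^+ 6 / 720)) _ _ s6).
    by move=> z _; eapply is_derive_eq; [der; exact: is_derive_sin|rewrite /=; field].
  by rewrite sin0; ring.
by move: (s7 x x0) (s5 x x0); rewrite !subr_ge0 => -> ->.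
Qed.

Lemma sin_piquarter_sqr : sin (pi / 4 : R) ^+ 2 = 1 / 2.
Proof.
have := cos_mulr2n (pi / 4 : R).
rewrite (_ : pi / 4 *+ 2 = pi / 2); last by rewrite -mulr_natr; field.
by rewrite cos_pihalf sin2cos2; lra.
Qed.

Lemma ler_sin_pihalf x y : - (pi / 2) <= x -> x <= y -> y <= pi / 2 ->
  sin x <= sin y :> R.
Proof.
move=> px xy yp; rewrite leNgt ltr_sin -?leNgt// in_itv/=.
  by rewrite yp (le_trans px).
by rewrite px (le_trans xy).
Qed.

(** As [sin (pi / 4) ^ 2 = 1/2] and [sin] increases on the first quadrant, a
    bound on [pi] follows from the Taylor bounds of [sin] at one quarter of the
    claimed value. *)
Lemma pi_bounds : 468 / 149 < (pi : R) < 1084 / 345.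
Proof.
have pi0 := pi_ge2 R; have := sin_piquarter_sqr.
set a := sin (pi / 4) => a2.
have a0 : 0 <= a by rewrite sin_ge0_pi//; lra.
apply/andP; split; rewrite ltNge; apply/negP => hpi.
- have /sin_bounds /andP[_] : 0 <= 117 / 149 :> R by lra.
  have : a <= sin (117 / 149).
    by apply: ler_sin_pihalf; lra.
  nra.
- have /sin_bounds /andP[+ _] : 0 <= 271 / 345 :> R by lra.
  have : sin (271 / 345) <= a.
    by apply: ler_sin_pihalf; lra.
  nra.
Qed.

Lemma sqrt2_bounds : 1393 / 985 < Num.sqrt (2 : R) < 577 / 408.
Proof.
have := @sqr_sqrtr R 2 ltac:(lra); have := sqrtr_ge0 (2 : R).
by move=> ? ?; apply/andP; split; nra.
Qed.

Lemma sqrt3_bounds : 989 / 571 < Num.sqrt (3 : R) < 1351 / 780.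
Proof.
have := @sqr_sqrtr R 3 ltac:(lra); have := sqrtr_ge0 (3 : R).
by move=> ? ?; apply/andP; split; nra.
Qed.

(** The factor [sqrt 2] turns the peak of the density into [pi ^ (-1/2)], so
    the bounds involve [pi] only. *)
Lemma phi_peak_bounds :
  321 / 569 < Num.sqrt 2 / Num.sqrt (2 * pi : R) < 79 / 140.
Proof.
have /andP[p1 p2] := pi_bounds.
rewrite sqrtrM// invfM mulrA divff ?sqrtr_eq0 -?ltNge// mul1r.
have := @sqr_sqrtr R pi (pi_ge0 R); have : 0 < Num.sqrt (pi : R) by rewrite sqrtr_gt0; lra.
set p := Num.sqrt _ => p0 pp.
by rewrite -[p^-1]div1r ltr_pdivlMr// ltr_pdivrMr//; apply/andP; split; nra.
Qed.

End Numerics.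

Section PhibarSqrt2.
Context {R : realType}.
Implicit Types u : R.

Lemma phi_exp u : phi u = (Num.sqrt (2 * pi))^-1 * expR (- (u ^+ 2 / 2)).
Proof. by rewrite /phi mulNr mulrC. Qed.

(** A primitive of [gauss_taylor], the Taylor polynomial of degree 6 of
    [exp (- v)] at [v = u^2 / 2]. *)
Definition gauss_poly u : R :=
  u - u ^+ 3 / 6 + u ^+ 5 / 40 - u ^+ 7 / 336 + u ^+ 9 / 3456
  - u ^+ 11 / (11 * 32 * 120) + u ^+ 13 / (13 * 64 * 720).

Definition gauss_taylor u : R := let v := u ^+ 2 / 2 in
  1 - v + v ^+ 2 / 2 - v ^+ 3 / 6 + v ^+ 4 / 24 - v ^+ 5 / 120 + v ^+ 6 / 720.

Lemma gauss_poly_derive u : is_derive u 1 gauss_poly (gauss_taylor u).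
Proof.
eapply is_derive_eq; first by rewrite /gauss_poly; der.
by rewrite /gauss_taylor/=; field.
Qed.

Lemma half_sqr_ge0 u : 0 <= u ^+ 2 / 2.
Proof. by rewrite divr_ge0 ?sqr_ge0. Qed.

Lemma Phibar_ge_gauss_poly u : 0 <= u ->
  1 / 2 - (Num.sqrt (2 * pi))^-1 * gauss_poly u <= Phibar u.
Proof.
move=> u0; set c := (Num.sqrt _)^-1; have c0 : 0 <= c by rewrite invr_ge0 sqrtr_ge0.
pose f w := - (c * gauss_poly w) - Phibar w.
have : f u <= f 0.
  have d (w : R) : is_derive w 1 f (- (c * gauss_taylor w) + phi w).
    have ? := @Phibar_derive R w; have ? := gauss_poly_derive w.
    by eapply is_derive_eq; [rewrite /f; der|rewrite /=; ring].
  apply: (le_of_derive_le0 u0 (fun w _ => d w)) => w _.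
  rewrite phi_exp -/c addrC subr_le0; apply: ler_wpM2l c0 _ _ _.
  exact: exp_taylor7 (half_sqr_ge0 w).
by rewrite /f Phibar0 /gauss_poly !expr0n/=; lra.
Qed.

Lemma Phibar_le_gauss_poly u : 0 <= u ->
  Phibar u <= 1 / 2 - (Num.sqrt (2 * pi))^-1 *
    (gauss_poly u - u ^+ 15 / (15 * 128 * 5040)).
Proof.
move=> u0; set c := (Num.sqrt _)^-1; have c0 : 0 <= c by rewrite invr_ge0 sqrtr_ge0.
pose f w := Phibar w + c * (gauss_poly w - w ^+ 15 / (15 * 128 * 5040)).
have : f u <= f 0.
  have d (w : R) : is_derive w 1 f
      (- phi w + c * (gauss_taylor w - (w ^+ 2 / 2) ^+ 7 / 5040)).
    have ? := @Phibar_derive R w; have ? := gauss_poly_derive w.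
    by eapply is_derive_eq; [rewrite /f; der|rewrite /=; field].
  apply: (le_of_derive_le0 u0 (fun w _ => d w)) => w _.
  rewrite phi_exp -/c addrC subr_le0; apply: ler_wpM2l c0 _ _ _.
  exact: exp_taylor8 (half_sqr_ge0 w).
by rewrite /f Phibar0 /gauss_poly !expr0n/=; lra.
Qed.

(** At [u = sqrt 2] the odd polynomials reduce to a rational multiple of
    [sqrt 2], whose product with the peak of [phi] is bounded by
    [phi_peak_bounds]. *)
Lemma Phibar_sqrt2_bounds : 15 / 191 <= Phibar (Num.sqrt (2 : R)) <= 17 / 216.
Proof.
have s0 := sqrtr_ge0 (2 : R).
have := Phibar_ge_gauss_poly s0; have := Phibar_le_gauss_poly s0.
have /andP[] := @phi_peak_bounds R.
have ss := @sqr_sqrtr R 2 ltac:(lra).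
move: ss; set s := Num.sqrt 2; set c := (Num.sqrt (2 * pi))^-1; move=> ss c1 c2.
have E n : s ^+ n.+2 = 2 * s ^+ n by rewrite -ss exprS exprS; ring.
rewrite /gauss_poly !E !expr1.
by move=> h1 h2; lra.
Qed.

End PhibarSqrt2.

Section GaussValues.
Context {R : realType}.
Implicit Types x y v : R.

Lemma phi_sqrt2_bounds :
  38 / 259 <= phi (Num.sqrt (2 : R)) <= 26 / 177.
Proof.
have /andP[c1 c2] := @phi_peak_bounds R; have /andP[s1 s2] := @sqrt2_bounds R.
have ss := @sqr_sqrtr R 2 ltac:(lra).
rewrite phi_exp ss divff ?pnatr_eq0//.
have := @exp_taylor7 R 1 ltac:(lra); have := @exp_taylor8 R 1 ltac:(lra).
move: c1 c2 s1 s2 ss; set s := Num.sqrt 2; set c := (Num.sqrt (2 * pi))^-1.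
set e := expR _; move=> c1 c2 s1 s2 ss e1 e2.
have -> : c * e = e * (s * c) * s / 2.
  rewrite (_ : e * (s * c) * s = s ^+ 2 * (c * e)); last by ring.
  by rewrite ss mulrAC divff ?pnatr_eq0// mul1r.
move: (s * c) c1 c2 => m m1 m2.
have e1' : 103 / 280 <= e by clear -e1; lra.
have e2' : e <= 113 / 307 by clear -e2; lra.
have /andP[w1 w2] : 103 / 280 * (321 / 569) <= e * m <= 113 / 307 * (79 / 140).
  apply/andP; split.
    by apply: ler_pM e1' (ltW m1); clear; lra.
  have e0 : 0 <= e by apply: le_trans e1'; clear; lra.
  have m0 : 0 <= m by apply: le_trans (ltW m1); clear; lra.
  exact: ler_pM e0 m0 e2' (ltW m2).
move: (e * m) w1 w2 => w w1 w2.
have /andP[] : 103 / 280 * (321 / 569) * (1393 / 985) <= w * s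
    <= 113 / 307 * (79 / 140) * (577 / 408).
  apply/andP; split.
    by apply: ler_pM w1 (ltW s1); clear; lra.
  have w0 : 0 <= w by apply: le_trans w1; clear; lra.
  have s0 : 0 <= s by apply: le_trans (ltW s1); clear; lra.
  exact: ler_pM w0 s0 w2 (ltW s2).
by move: (w * s) => z; clear => z1 z2; apply/andP; split; lra.
Qed.

Lemma phi_sqrt3_ge : 11 / 125 <= phi (Num.sqrt (3 : R)).
Proof.
have /andP[c1 c2] := @phi_peak_bounds R; have /andP[s1 s2] := @sqrt2_bounds R.
rewrite phi_exp sqr_sqrtr; last by lra.
have := @exp_taylor8 R (3 / 2) ltac:(lra).
move: c1 c2 s1 s2; set s := Num.sqrt 2; set c := (Num.sqrt (2 * pi))^-1.
set e := expR _; move=> c1 c2 s1 s2 e1.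
have c3 : 39 / 98 <= c.
  have s0 : 0 < s by clear -s1; lra.
  by rewrite -(ler_pM2l s0); clear -s2 c1; lra.
have e3 : 2 / 9 <= e by clear -e1; lra.
have : 39 / 98 * (2 / 9) <= c * e.
  by clear -c3 e3; apply: ler_pM; lra.
by move: (c * e) => z; clear; lra.
Qed.

End GaussValues.

(** * Bounds for the Mills ratio *)
Section MillsRatio.
Context {R : realType}.
Implicit Types x y v : R.

(** [Phibar] vanishes at infinity, so on a half-line it is enough to compare
    derivatives. *)
Lemma Phibar_le_of_derive (G : R -> R) (dG : R -> R) (a : R) :
  (forall u : R, a <= u -> is_derive u 1 G (dG u)) ->
  (forall u : R, a <= u -> dG u <= - phi u) ->
  (forall u : R, a <= u -> 0 <= G u) -> Phibar a <= G a.
Proof.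
move=> dGE dGle G0; apply/ler_addgt0Pr => e e0.
have [M hM] := Phibar_vanishes e0.
pose b := Num.max a M.
have ab : a <= b by rewrite le_max lexx.
have /hM Fb : M <= b by rewrite le_max lexx orbT.
have dF := @Phibar_derive R.
have : G b - Phibar b <= G a - Phibar a.
  apply: (@le_of_derive_le0 R (fun u => G u - Phibar u)
    (fun u => dG u - - phi u)) => // u /andP[au _].
    by have ? := dGE u au; have ? := dF u; der.
  by rewrite subr_le0 dGle.
have := G0 b ab; lra.
Qed.

Lemma Phibar_ge_of_derive (G : R -> R) (dG : R -> R) (a : R) :
  (forall u : R, a <= u -> is_derive u 1 G (dG u)) ->
  (forall u : R, a <= u -> - phi u <= dG u) ->
  (forall e : R, 0 < e -> exists M : R, forall u : R, M <= u -> G u <= e) ->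
  G a <= Phibar a.
Proof.
move=> dGE dGge G0; apply/ler_addgt0Pr => e e0.
have [M hM] := G0 _ e0.
pose b := Num.max a M.
have ab : a <= b by rewrite le_max lexx.
have /hM Gb : M <= b by rewrite le_max lexx orbT.
have dF := @Phibar_derive R.
have : Phibar b - G b <= Phibar a - G a.
  apply: (@le_of_derive_le0 R (fun u => Phibar u - G u)
    (fun u => - phi u - dG u)) => // u /andP[au _].
    by have ? := dGE u au; have ? := dF u; der.
  by rewrite subr_le0 dGge.
have := Phibar_ge0 b; lra.
Qed.

Lemma phi_vanishes (e : R) : 0 < e -> exists M : R,
  forall u : R, M <= u -> phi u <= e.
Proof.
move=> e0; exists (Num.max 1 (1 / e)) => u; rewrite ge_max => /andP[u1 ue].
have u0 : 0 < u by lra.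
have c1 : (Num.sqrt (2 * pi : R))^-1 <= 1.
  rewrite invf_le1 ?sqrtr_gt0 -?[leLHS]sqrtr1 ?ler_sqrt; have := @pi_ge2 R; lra.
have h : expR (- (u ^+ 2 / 2)) <= u^-1.
  rewrite expRN lef_pV2 ?posrE ?expR_gt0//.
  by apply: le_trans (expR_ge1Dx _); nra.
rewrite phi_exp; apply: (@le_trans _ _ (1 * u^-1)).
  by apply: ler_pM => //; rewrite ?invr_ge0 ?sqrtr_ge0// expR_ge0.
by rewrite mul1r -[e]invrK lef_pV2 ?posrE ?invr_gt0// -div1r.
Qed.

(** The rational factors here and in [Mills_lower] are convergents of
    Laplace's continued fraction for [Phibar / phi]: for them the derivative of
    [phi] times the factor is [- phi] up to a correction of constant sign. *)
Lemma Mills_upper (a : R) : 0 < a ->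
  Phibar a <= phi a * ((a ^+ 2 + 2) / (a * (a ^+ 2 + 3))).
Proof.
move=> a0.
pose dG (u : R) := - phi u * (1 + 6 / (u ^+ 2 * (u ^+ 2 + 3) ^+ 2)).
apply: (@Phibar_le_of_derive
  (fun u => phi u * ((u ^+ 2 + 2) / (u * (u ^+ 2 + 3)))) dG).
- move=> u au; have u0 : 0 < u by lra.
  have ? := @phi_derive R u.
  have uu0 := exprn_gt0 2 u0.
  by eapply is_derive_eq; [der; nra|rewrite /dG/=; field; nra].
- move=> u au; rewrite /dG; have := phi_gt0 u; set d := 6 / _.
  have : 0 <= d by rewrite divr_ge0// mulr_ge0// sqr_ge0.
  by nra.
- move=> u au; have u0 : 0 < u by lra.
  by rewrite mulr_ge0 ?ltW ?phi_gt0// divr_gt0//; nra.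
Qed.

Lemma Mills_lower (a : R) : 0 < a ->
  phi a * (a * (a ^+ 2 + 5) / (a ^+ 4 + 6 * a ^+ 2 + 3)) <= Phibar a.
Proof.
move=> a0.
pose dG (u : R) := - phi u * (1 - 24 / (u ^+ 4 + 6 * u ^+ 2 + 3) ^+ 2).
apply: (@Phibar_ge_of_derive (fun u =>
  phi u * (u * (u ^+ 2 + 5) / (u ^+ 4 + 6 * u ^+ 2 + 3))) dG).
- move=> u au; have u0 : 0 < u by lra.
  have ? := @phi_derive R u.
  have uu0 := exprn_gt0 2 u0.
  by eapply is_derive_eq; [der; nra|rewrite /dG/=; field; nra].
- move=> u au; rewrite /dG; have := phi_gt0 u; set d := 24 / _.
  have : 0 <= d by rewrite divr_ge0// sqr_ge0.
  by nra.
- move=> e /phi_vanishes[M hM]; exists (Num.max M 1) => u.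
  rewrite ge_max => /andP[/hM pu u1]; apply: le_trans pu.
  apply: ler_piMr; first by rewrite ltW ?phi_gt0.
  by rewrite ler_pdivrMr ?mul1r; nra.
Qed.

End MillsRatio.

(** * The monotonicity behind the induction step *)
Section Step.
Context {R : realType}.
Implicit Types x t y u : R.

(** The truncated power series of [artanh y = ln ((1 + y) / (1 - y)) / 2]. *)
Lemma artanh_ge y : 0 <= y < 1 ->
  (1 - y) * expR (2 * (y + y ^+ 3 / 3 + y ^+ 5 / 5)) <= 1 + y.
Proof.
move=> /andP[y0 y1].
pose f u := 2 * (u + u ^+ 3 / 3 + u ^+ 5 / 5) + ln (1 - u) - ln (1 + u).
have d u : 0 <= u <= y ->
    is_derive u 1 f (- (2 * u ^+ 6 / ((1 - u) * (1 + u)))).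
  move=> /andP[u0 uy].
  rewrite /f; eapply is_derive_eq; first by der; lra.
  have u1 : 1 - u != 0 by rewrite gt_eqF//; lra.
  have u2 : 1 + u != 0 by rewrite gt_eqF//; lra.
  by rewrite /=; field; rewrite u1 u2.
have : f y <= f 0.
  apply: (le_of_derive_le0 y0 d) => u /andP[u0 uy].
  rewrite oppr_le0 divr_ge0 ?mulr_ge0 ?exprn_even_ge0//; lra.
rewrite /f !expr0n/= subr0 addr0 ln1 !mul0r !addr0 mulr0 subr0 => h.
rewrite -{1}[1 - y]lnK ?posrE; last by lra.
rewrite -expRD -[leRHS]lnK ?posrE; last by lra.
by rewrite ler_expR; lra.
Qed.

Lemma rescaled_derive x t : 0 < 1 - t ^+ 2 ->
  is_derive t 1 (fun u => (x + u) / Num.sqrt (1 - u ^+ 2))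
    ((1 + x * t) / Num.sqrt (1 - t ^+ 2) ^+ 3).
Proof.
move=> t1; pose th u : R := Num.sqrt (1 - u ^+ 2).
have thN : th t != 0 by rewrite sqrtr_eq0 -ltNge.
have ? : is_derive t 1 th (- t / th t).
  by rewrite /th; eapply is_derive_eq; [by der|rewrite /=; field].
rewrite -/(th t) (_ : (fun u => _) = fun u => (x + u) / th u)//.
eapply is_derive_eq; first by der.
rewrite (_ : 1 + x * t = th t ^+ 2 + t ^+ 2 + x * t).
  by rewrite /=; field.
by rewrite /th sqr_sqrtr ?ltW//; ring.
Qed.

(** The two levels [(x - t) / sqrt (1 - t^2)] and [(x + t) / sqrt (1 - t^2)]
    have derivatives [- (1 - x t)] and [1 + x t], up to the common factor
    [(1 - t^2) ^ (-3/2)], and the density at the first is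
    [exp (2 x t / (1 - t^2))] times the density at the second.  Hence the
    hypothesis says exactly that the derivative of the sum is nonpositive.
    Two different functions are allowed since the second level may lie in a
    range where another bound is in force. *)
Lemma step_nincr (f g wf wg : R -> R) x a b : 0 <= a -> a <= b -> b < 1 ->
  (forall u, is_derive u 1 f (- (wf u * phi u))) ->
  (forall u, is_derive u 1 g (- (wg u * phi u))) ->
  (forall t, a <= t <= b ->
    (1 - x * t) * expR (2 * (x * t / (1 - t ^+ 2))) *
      wf ((x - t) / Num.sqrt (1 - t ^+ 2)) <=
    (1 + x * t) * wg ((x + t) / Num.sqrt (1 - t ^+ 2))) ->
  f ((x - b) / Num.sqrt (1 - b ^+ 2)) + g ((x + b) / Num.sqrt (1 - b ^+ 2)) <=
  f ((x - a) / Num.sqrt (1 - a ^+ 2)) + g ((x + a) / Num.sqrt (1 - a ^+ 2)).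
Proof.
move=> a0 ab b1 df dg h.
pose th t : R := Num.sqrt (1 - t ^+ 2).
pose A t := (x - t) / th t; pose B t := (x + t) / th t.
have tt t : a <= t <= b -> 0 < 1 - t ^+ 2.
  by move=> /andP[at' tb]; nra.
have th0 t : a <= t <= b -> 0 < th t by move=> /tt ?; rewrite sqrtr_gt0.
have thE t : a <= t <= b -> th t ^+ 2 = 1 - t ^+ 2.
  by move=> /tt ?; rewrite sqr_sqrtr// ltW.
have thN t : a <= t <= b -> th t != 0 by move=> /th0 ?; rewrite gt_eqF.
have dB t : a <= t <= b -> is_derive t 1 B ((1 + x * t) / th t ^+ 3).
  by move=> /tt; exact: rescaled_derive.
have dA t : a <= t <= b -> is_derive t 1 A (- (1 - x * t) / th t ^+ 3).
  move=> /tt t1; have ? := rescaled_derive (- x) t1.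
  rewrite (_ : A = fun u => - ((- x + u) / th u)); last first.
    by apply/funext => u; rewrite /A -mulNr opprD opprK.
  by eapply is_derive_eq; [eapply deriv1_opp; eassumption|rewrite -/(th t); ring].
pose G t := f (A t) + g (B t).
have dG t : a <= t <= b -> is_derive t 1 G
    ((1 - x * t) * (wf (A t) * phi (A t)) / th t ^+ 3 -
     (1 + x * t) * (wg (B t) * phi (B t)) / th t ^+ 3).
  move=> tab; have ? := dA t tab; have ? := dB t tab; have ? := thN t tab.
  rewrite /G; eapply is_derive_eq.
    eapply deriv1_add; [exact: (deriv1_comp (df _) _)|exact: (deriv1_comp (dg _) _)].
  by rewrite /=; field.
apply: (le_of_derive_le0 ab dG) => t tab.
have phiA : phi (A t) = expR (2 * (x * t / (1 - t ^+ 2))) * phi (B t).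
  rewrite /phi mulrA -expRD; congr (expR _ / _).
  rewrite /A /B !exprMn -thE// exprVn.
  by have := thN t tab => ?; field.
rewrite -mulrBl pmulr_lle0 ?invr_gt0 ?exprn_gt0 ?th0// subr_le0.
rewrite phiA; have := phi_gt0 (B t); set p := phi (B t); set e := expR _ => p0.
rewrite (_ : _ * (_ * (e * p)) = (1 - x * t) * e * wf (A t) * p); last by ring.
by rewrite mulrA ler_pM2r//; exact: h.
Qed.

(** If [x t / (1 - t^2)] exceeds the truncated series of [artanh (x t)] by at
    most [E], the exponential is at most [exp (2 E)] times
    [(1 + x t) / (1 - x t)], and [1 - 2 E <= exp (- 2 E)] makes the condition
    on the weights linear. *)
Lemma cond_of_linear x t wA wB E : 0 <= x * t < 1 ->
  x * t / (1 - t ^+ 2) <=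
    x * t + (x * t) ^+ 3 / 3 + (x * t) ^+ 5 / 5 + E ->
  0 <= wA -> 0 <= wB -> wA <= wB * (1 - 2 * E) ->
  (1 - x * t) * expR (2 * (x * t / (1 - t ^+ 2))) * wA <= (1 + x * t) * wB.
Proof.
set y := x * t; set p := y + _ + _ => y01 hE wA0 wB0 hw.
have /andP[y0 y1] := y01.
apply: (@le_trans _ _ ((1 - y) * (expR (2 * p) * expR (2 * E)) * wA)).
  rewrite ler_wpM2r// ler_wpM2l ?subr_ge0 ?(ltW y1)// -expRD ler_expR.
  by clearbody p y; lra.
rewrite mulrA -mulrA ler_pM ?mulr_ge0 ?expR_ge0 ?subr_ge0 ?(ltW y1)//.
  exact: artanh_ge.
apply: le_trans (ler_wpM2l (expR_ge0 _) hw) _.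
rewrite mulrCA ler_piMr// mulrC -ler_pdivlMr ?expR_gt0// mul1r -expRN.
exact: expR_ge1Dx.
Qed.

End Step.

Section GaussStep.
Context {R : realType}.
Implicit Types x t y u : R.

Lemma step_at0 (f : R -> R) x :
  f ((x - 0) / Num.sqrt (1 - 0 ^+ 2)) + f ((x + 0) / Num.sqrt (1 - 0 ^+ 2)) =
  2 * f x.
Proof. by rewrite subr0 addr0 expr0n/= subr0 sqrtr1 divr1; ring. Qed.

(** As [x^2 >= 3], one has [u^2 <= y^2 / 3] with [y = x u], so [y / (1 - u^2)]
    is at most [y / (1 - y^2 / 3) = y + y^3/3 + y^5/9 + ...], which is at most
    [y + y^3/3 + y^5/5] for [y < 1].  For [y >= 1] the left-hand side of the condition
    is nonpositive. *)
Lemma Phibar_step x t : Num.sqrt 3 <= x -> 0 <= t < 1 ->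
  Phibar ((x - t) / Num.sqrt (1 - t ^+ 2)) +
  Phibar ((x + t) / Num.sqrt (1 - t ^+ 2)) <= 2 * Phibar x.
Proof.
move=> qx /andP[t0 t1]; rewrite -step_at0.
have x0 : 0 <= x by apply: le_trans qx; exact: sqrtr_ge0.
have x3 : 3 <= x ^+ 2.
  rewrite -[3]sqr_sqrtr; last by lra.
  by rewrite ler_sqr ?nnegrE ?sqrtr_ge0.
have dF u : is_derive u 1 (@Phibar R) (- (1 * phi u)).
  by rewrite mul1r; exact: Phibar_derive.
apply: (step_nincr (lexx 0) t0 t1 dF dF) => u /andP[u0 ut].
have u1 : 0 < 1 - u ^+ 2 by nra.
have y0 : 0 <= x * u by rewrite mulr_ge0.
have [y1|y1] := leP 1 (x * u).
  apply: (@le_trans _ _ 0); last by rewrite mulr1 addr_ge0.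
  by rewrite mulr1 mulr_le0_ge0 ?expR_ge0 ?subr_le0.
apply: (@cond_of_linear R x u 1 1 0); rewrite ?y0 ?y1 ?addr0 ?mulr0 ?subr0 ?mulr1//.
rewrite ler_pdivrMr//.
have : u ^+ 2 <= (x * u) ^+ 2 / 3.
  by rewrite exprMn; have := sqr_ge0 u; move: (x^+2) (u^+2) x3 => X U X3 U0; nra.
move: (x * u) (u ^+ 2) y0 y1 => y U y0 y1 hU.
have p0 : 0 <= y + y ^+ 3 / 3 + y ^+ 5 / 5.
  by rewrite !addr_ge0// mulr_ge0 ?exprn_ge0.
have : (y + y ^+ 3 / 3 + y ^+ 5 / 5) * (1 - y ^+ 2 / 3) <=
    (y + y ^+ 3 / 3 + y ^+ 5 / 5) * (1 - U) by apply: ler_wpM2l => //; lra.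
apply: le_trans; rewrite -subr_ge0.
rewrite (_ : _ - y = y ^+ 5 * (4 - 3 * y ^+ 2) / 45); last by field.
by rewrite !mulr_ge0 ?exprn_ge0//; nra.
Qed.

(** The terms of order one and three in [t] account for [t^3 (x - x^3 / 3)].
    For the rest, [x^4 / 5 + 81/200] has to be at least [1 / (1 - t^2)]: the
    left side is at least [4/5 + 81/200 = 1.205], and the right side is at
    most [1 / 0.83]. *)
Lemma excess_bound x t : 0 <= x -> 2 <= x ^+ 2 -> 0 <= t <= 103 / 250 ->
  x * t / (1 - t ^+ 2) <= x * t + (x * t) ^+ 3 / 3 + (x * t) ^+ 5 / 5 +
    t ^+ 3 * (x - x ^+ 3 / 3 + 81 / 200 * t ^+ 2 * x).
Proof.
move=> x0 x2 /andP[t0 t1].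
have s1 : t ^+ 2 <= 17 / 100 by nra.
have s2 : 0 < 1 - t ^+ 2 by lra.
rewrite -subr_ge0 (_ : _ - _ = x * t * (t ^+ 2) ^+ 2 / (1 - t ^+ 2) *
    ((x ^+ 2 * x ^+ 2 / 5 + 81 / 200) * (1 - t ^+ 2) - 1)); last first.
  by field; rewrite gt_eqF.
apply: mulr_ge0.
  apply: divr_ge0; last exact: ltW.
  by apply: mulr_ge0; [exact: mulr_ge0|exact: sqr_ge0].
have : 4 <= x ^+ 2 * x ^+ 2 by move: (x ^+ 2) x2 => X; nra.
move: (x ^+ 2 * _) (t ^+ 2) s1 s2 => Z S; nra.
Qed.

End GaussStep.

(** * The polynomial inequalities for levels between sqrt 2 and sqrt 3 *)
Section MidStep.
Context {R : realType}.
Implicit Types x t u : R.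
Local Notation s2 := (Num.sqrt 2 : R).
Local Notation s3 := (Num.sqrt 3 : R).

Lemma inv_sqrt_le t : 0 <= t <= 103 / 250 ->
  1 <= (Num.sqrt (1 - t ^+ 2))^-1 <= 1 + 23 / 40 * t ^+ 2.
Proof.
move=> /andP[t0 t1].
have h : t ^+ 2 <= 17 / 100 by nra.
have h0 := sqr_ge0 t.
set th := Num.sqrt _.
have hh : th ^+ 2 = 1 - t ^+ 2 by rewrite sqr_sqrtr//; lra.
have th0 : 0 < th by rewrite sqrtr_gt0; lra.
clearbody th; move: (t ^+ 2) h h0 hh => s h h0 hh.
rewrite -div1r ler_pdivlMr// ler_pdivrMr//; apply/andP; split; first by nra.
rewrite -(@ler_sqr _ 1) ?nnegrE//; last by apply: mulr_ge0; lra.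
rewrite exprMn hh expr1n; nra.
Qed.

(** The concave function [x - x^3 / 3] lies below its tangent at [sqrt 2]. *)
Lemma cubic_tangent x : 0 <= x -> x - x ^+ 3 / 3 <= 4 * s2 / 3 - x.
Proof.
move=> x0; rewrite -subr_ge0.
have ss : s2 ^+ 2 = 2 by rewrite sqr_sqrtr//; lra.
have s0 : 0 <= s2 by exact: sqrtr_ge0.
have -> : 4 * s2 / 3 - x - (x - x ^+ 3 / 3) =
    (x - s2) ^+ 2 * (x + 2 * s2) / 3 + (2 - s2 ^+ 2) * (2 * s2 - 3 * x) / 3.
  by field.
rewrite ss subrr !mul0r addr0.
by apply: divr_ge0 => //; apply: mulr_ge0; rewrite ?sqr_ge0// addr_ge0// mulr_ge0.
Qed.

(** The loss from the exponential, as it enters when both levels are below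
    [sqrt 3]: there the two weights differ by at least [7/50 * 2 t], and the
    weight at the second level is at most [111/100]. *)
Lemma excess_small x t : s2 <= x <= s3 -> 0 <= t <= 103 / 250 ->
  2 * (t ^+ 3 * (x - x ^+ 3 / 3 + 81 / 200 * t ^+ 2 * x)) * (111 / 100)
    <= 7 / 25 * t.
Proof.
move=> /andP[x1 x2] /andP[t0 t1].
have /andP[a1 a2] := @sqrt2_bounds R; have /andP[b1 b2] := @sqrt3_bounds R.
have x0 : 0 <= x by clear -x1 a1; lra.
have := cubic_tangent x0; set z := x - _ => hz.
have s1 : t ^+ 2 <= 17 / 100 by nra.
have s0 := sqr_ge0 t.
have hz' : z <= 4716 / 1000 / 10 by clear -hz x1 a2; lra.
have hx : 81 / 200 * t ^+ 2 * x <= 12 / 100.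
  have : t ^+ 2 * x <= 17 / 100 * (1351 / 780).
      by apply: ler_pM s0 x0 s1 _; exact: le_trans x2 (ltW b2).
  by clear; lra.
have : t ^+ 2 * (z + 81 / 200 * t ^+ 2 * x) <= 17 / 100 * (5916 / 1000 / 10).
  have : z + 81 / 200 * t ^+ 2 * x <= 5916 / 1000 / 10.
    by clear -hz' hx; lra.
  by move: (z + _) => Z; move: (t ^+ 2) s0 s1 => S; clear; nra.
rewrite (exprSr t 2); move: (z + _) => Z; move: (t ^+ 2) => S; clear -t0; nra.
Qed.

(** The loss as it enters when the second level is above [sqrt 3]: the gap
    between the weights is then [7/50] times the distance from the first level
    to [sqrt 3], and [238/235] bounds the weight at the second level. *)
Lemma excess_gap x t : s2 <= x <= s3 -> 0 <= t <= 103 / 250 ->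
  2 * (t ^+ 3 * (x - x ^+ 3 / 3 + 81 / 200 * t ^+ 2 * x)) * (238 / 235)
    <= 7 / 50 * (s3 - (x - t) * (1 + 23 / 40 * t ^+ 2)).
Proof.
move=> /andP[x1 x2] /andP[t0 t1].
have /andP[a1 a2] := @sqrt2_bounds R; have /andP[b1 b2] := @sqrt3_bounds R.
have x0 : 0 <= x by clear -x1 a1; lra.
have := cubic_tangent x0; move: x1 x2 a1 a2 b1 b2.
set s := s2; set q := s3; set z := x - _ => x1 x2 a1 a2 b1 b2 hz.
have t3 : 0 <= t ^+ 3 by rewrite exprn_ge0.
(* Once the cubic in [x] is replaced by its tangent, the difference of the two
   sides is affine in [x], so only both ends of the interval matter. *)
pose f (v : R) := 7 / 50 * (q - (v - t) * (1 + 23 / 40 * t ^+ 2)) -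
  2 * (t ^+ 3 * (4 * s / 3 - v + 81 / 200 * t ^+ 2 * v)) * (238 / 235).
suff fx : 0 <= f x.
  apply: (@le_trans _ _ (2 * (t ^+ 3 * (4 * s / 3 - x + 81 / 200 * t ^+ 2 * x))
    * (238 / 235))); last by rewrite -subr_ge0.
  have c0 : 0 < 238 / 235 :> R by clear; lra.
  by rewrite (ler_pM2r c0) ler_pM2l// ler_wpM2l//; clear -hz; lra.
have t2 : t ^+ 2 <= 17 / 100 by clear -t0 t1; nra.
have tt := sqr_ge0 t.
have fs : 0 <= f s.
  have h0 : t ^+ 2 * s <= t ^+ 2 * (577 / 408) by rewrite ler_wpM2l// ltW.
  have h : 4 * s / 3 - s + 81 / 200 * t ^+ 2 * s <= 57 / 100.
    by clear -h0 t2 a2; lra.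
  have h1 : t ^+ 3 * (4 * s / 3 - s + 81 / 200 * t ^+ 2 * s) <= t ^+ 3 * (57 / 100).
    by rewrite ler_wpM2l.
  have h2 : 317 / 1000 + t - 814 / 1000 * t ^+ 2 + 23 / 40 * t ^+ 3 <=
      q - (s - t) * (1 + 23 / 40 * t ^+ 2).
    by clear -h0 b1 a2 tt; lra.
  rewrite /f; clear -t0 t1 h1 h2.
  have : t ^+ 3 <= 103 / 250 * t ^+ 2.
    by rewrite exprS ler_wpM2r ?sqr_ge0.
  have : t ^+ 2 <= 103 / 250 * t by rewrite expr2 ler_wpM2r.
  move: (t ^+ 3 * _) (_ - (s - t) * _) h1 h2 => a b; lra.
have fq : 0 <= f q.
  have h0 : t ^+ 2 * q <= t ^+ 2 * (1351 / 780) by rewrite ler_wpM2l// ltW.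
  have h : 4 * s / 3 - q + 81 / 200 * t ^+ 2 * q <= 2735 / 1000 / 10.
    by clear -h0 t2 a2 b1; lra.
  have h1 : t ^+ 3 * (4 * s / 3 - q + 81 / 200 * t ^+ 2 * q) <=
      t ^+ 3 * (2735 / 1000 / 10) by rewrite ler_wpM2l.
  have h2 : t - 23 / 40 * (1351 / 780) * t ^+ 2 + 23 / 40 * t ^+ 3 <=
      q - (q - t) * (1 + 23 / 40 * t ^+ 2).
    by clear -h0; lra.
  rewrite /f; clear -t0 t1 h1 h2.
  have h3 : t ^+ 3 <= 103 / 250 * t ^+ 2.
    by rewrite exprS ler_wpM2r ?sqr_ge0.
  have h4 : t ^+ 2 <= 103 / 250 * t by rewrite expr2 ler_wpM2r.
  move: (t ^+ 3 * _) (_ - (q - t) * _) h1 h2 => a b; lra.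
have qs : 0 < q - s by clear -a2 b1; lra.
rewrite -(pmulr_lge0 _ qs).
have -> : f x * (q - s) = f s * (q - x) + f q * (x - s) by rewrite /f; field.
by apply: addr_ge0; [apply: mulr_ge0 fs _|apply: mulr_ge0 fq _]; rewrite subr_ge0.
Qed.

End MidStep.

(** * The bound for levels between sqrt 2 and sqrt 3 *)
Section MidRange.
Context {R : realType}.
Implicit Types x t u : R.
Local Notation s2 := (Num.sqrt 2 : R).
Local Notation s3 := (Num.sqrt 3 : R).

Lemma Phibar_gt0 x : 0 < Phibar x.
Proof.
pose y := Num.max x 1.
have y0 : 0 < y by rewrite lt_max ltr01 orbT.
apply: (@lt_le_trans _ _ (Phibar y)); last first.
  by apply: Phibar_anti; rewrite le_max lexx.
apply: lt_le_trans (Mills_lower y0).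
by rewrite mulr_gt0 ?phi_gt0// divr_gt0 ?mulr_gt0 ?addr_gt0 ?exprn_gt0 ?mulr_gt0 ?exprn_gt0.
Qed.

Definition c2_div_c1 : R := 1 + 1 / 250 * (1 + inv_mills s3).

Lemma c2_div_c1_bounds : 165 / 163 <= c2_div_c1 <= 238 / 235.
Proof.
have q0 : 0 < s3 by rewrite sqrtr_gt0; lra.
have qq : s3 ^+ 2 = 3 by rewrite sqr_sqrtr//; lra.
have /andP[b1 b2] := @sqrt3_bounds R.
have := Mills_upper q0; have := Mills_lower q0.
have -> : s3 ^+ 4 = 9 by rewrite (exprM _ 2 2) qq; ring.
rewrite qq /c2_div_c1 /inv_mills; have := Phibar_gt0 s3; have := phi_gt0 s3.
move: (Phibar s3) (phi s3) => F p p0 F0 h1 h2.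
have k1 : 6 / 5 * s3 <= p / F.
  rewrite ler_pdivlMr//; apply: le_trans (ler_wpM2l _ h2) _; first by lra.
  by rewrite le_eqVlt; apply/orP; left; apply/eqP; field; rewrite gt_eqF.
have k2 : p / F <= 15 / (4 * s3).
  rewrite ler_pdivrMr//; apply: (@le_trans _ _ (15 / (4 * s3) *
    (p * (s3 * (3 + 5) / (9 + 6 * 3 + 3))))).
    by rewrite le_eqVlt; apply/orP; left; apply/eqP; field; rewrite gt_eqF.
  by rewrite ler_wpM2l// divr_ge0// mulr_ge0// ltW.
have k3 : 15 / (4 * s3) <= 2166 / 1000.
  by rewrite ler_pdivrMr ?mulr_gt0//; clear -b1; lra.
have k4 : 2078 / 1000 <= 6 / 5 * s3 by clear -b1; lra.
by move: (p / F) k1 k2 => r; clear -k3 k4 => k1 k2; apply/andP; split; lra.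
Qed.

(** The function that equals [c2_div_c1 * Phibar] at [sqrt 3] and has
    derivative [- mid_weight * phi].  The slope [7/50] of the weight is large
    enough for the induction step and small enough to keep [mid_bound] above
    [Phibar] at [sqrt 2]. *)
Definition mid_bound x : R := c2_div_c1 * Phibar x
  - 7 / 50 * (s3 * (Phibar x - Phibar s3) - (phi x - phi s3)).

Definition mid_weight u : R := c2_div_c1 - 7 / 50 * (s3 - u).

Lemma mid_bound_derive x :
  is_derive x 1 mid_bound (- (mid_weight x * phi x)).
Proof.
have ? := @Phibar_derive R x; have ? := @phi_derive R x.
rewrite /mid_bound; eapply is_derive_eq; first by der.
by rewrite /mid_weight /=; ring.
Qed.

Lemma c2_div_c1_Phibar_derive x :
  is_derive x 1 (fun u => c2_div_c1 * Phibar u) (- (c2_div_c1 * phi x)).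
Proof.
have ? := @Phibar_derive R x; eapply is_derive_eq; first by der.
by rewrite /=; ring.
Qed.

Lemma mid_bound_sqrt3 : mid_bound s3 = c2_div_c1 * Phibar s3.
Proof. by rewrite /mid_bound !subrr mulr0 subr0 mulr0 subr0. Qed.

(** The bound of [excess_bound] for the amount by which [x t / (1 - t^2)]
    exceeds the truncated series of [artanh (x t)]. *)
Definition excess x t := t ^+ 3 * (x - x ^+ 3 / 3 + 81 / 200 * t ^+ 2 * x).

Lemma mid_cond_common x t : s2 <= x <= s3 -> 0 <= t <= 103 / 250 ->
  let E := excess x t in let th := (Num.sqrt (1 - t ^+ 2))^-1 in
  [/\ 0 <= x * t < 1, x * t / (1 - t ^+ 2) <=
      x * t + (x * t) ^+ 3 / 3 + (x * t) ^+ 5 / 5 + E, 0 <= E,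
      0 <= mid_weight ((x - t) * th) & 0 <= mid_weight ((x + t) * th) <= 111 / 100].
Proof.
move=> hx ht E th.
have /andP[x1 x2] := hx; have /andP[t0 t1] := ht.
have /andP[a1 a2] := @sqrt2_bounds R; have /andP[b1 b2] := @sqrt3_bounds R.
have /andP[g1 g2] := c2_div_c1_bounds.
have /andP[i1 i2] : 1 <= th <= 1 + 23 / 40 * t ^+ 2 := inv_sqrt_le ht.
clearbody th.
have x0 : 0 <= x by clear -x1 a1; lra.
have x14 : 14 / 10 <= x by clear -x1 a1; lra.
have x18 : x <= 174 / 100 by clear -x2 b2; lra.
have xx : 2 <= x ^+ 2.
  have aa : s2 ^+ 2 = 2 by rewrite sqr_sqrtr//; lra.
  by rewrite -aa ler_sqr ?nnegrE ?sqrtr_ge0.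
have xx3 : x ^+ 2 <= 3.
  have qq : s3 ^+ 2 = 3 by rewrite sqr_sqrtr//; lra.
  by rewrite -qq ler_sqr ?nnegrE ?sqrtr_ge0.
have tt : t ^+ 2 <= 17 / 100 by clear -t0 t1; nra.
have th1 : th <= 11 / 10.
  by apply: le_trans i2 _; clear -tt; lra.
have A0 : 0 <= (x - t) * th by apply: mulr_ge0; clear -x14 t1 i1; lra.
have B2 : (x + t) * th <= 2152 / 1000 * (11 / 10).
  by apply: ler_pM => //; clear -x14 t0 i1 x18 t1; lra.
have B0 : 0 <= (x + t) * th by apply: mulr_ge0; clear -x14 t0 i1; lra.
split.
- apply/andP; split; first exact: mulr_ge0.
  apply: (@le_lt_trans _ _ (174 / 100 * (103 / 250))); last by clear; lra.
  exact: ler_pM x0 t0 x18 t1.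
- exact: excess_bound.
- apply: mulr_ge0; first exact: exprn_ge0.
  apply: addr_ge0; last first.
    apply: mulr_ge0 _ x0; apply: mulr_ge0 _ (sqr_ge0 t).
    by clear; lra.
  rewrite (_ : x - _ = x * (1 - x ^+ 2 / 3)); last by field.
  by rewrite mulr_ge0//; clear -xx3; lra.
- by rewrite /mid_weight; clear -A0 g1 b2; lra.
- by rewrite /mid_weight; clear -B0 B2 g1 g2 b1 b2; apply/andP; split; lra.
Qed.

Lemma mid_cond_below x t : s2 <= x <= s3 -> 0 <= t <= 103 / 250 ->
  (1 - x * t) * expR (2 * (x * t / (1 - t ^+ 2))) *
    mid_weight ((x - t) / Num.sqrt (1 - t ^+ 2)) <=
  (1 + x * t) * mid_weight ((x + t) / Num.sqrt (1 - t ^+ 2)).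
Proof.
move=> hx ht; have [] := mid_cond_common hx ht.
set E := excess x t; set th := (Num.sqrt _)^-1 => y1 hE E0 wA /andP[wB0 wB1].
apply: (cond_of_linear y1 hE wA wB0).
have /andP[t0 t1] := ht; have /andP[i1 i2] := inv_sqrt_le ht.
have hes := excess_small hx ht.
apply: (@le_trans _ _ (mid_weight ((x + t) * th) - 2 * E * (111 / 100))).
  have : t <= t * th by rewrite ler_peMr.
  by rewrite /mid_weight -/th; move: hes; rewrite -/(excess x t) -/E; clear; lra.
rewrite mulrBr mulr1 lerB// mulrC; apply: ler_wpM2l => //.
by rewrite mulr_ge0.
Qed.

Lemma mid_cond_above x t : s2 <= x <= s3 -> 0 <= t <= 103 / 250 ->
  (1 - x * t) * expR (2 * (x * t / (1 - t ^+ 2))) *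
    mid_weight ((x - t) / Num.sqrt (1 - t ^+ 2)) <= (1 + x * t) * c2_div_c1.
Proof.
move=> hx ht; have [] := mid_cond_common hx ht.
set E := excess x t; set th := (Num.sqrt _)^-1 => y1 hE E0 wA _.
have /andP[g1 g2] := c2_div_c1_bounds.
apply: (cond_of_linear y1 hE wA); first by clear -g1; lra.
have /andP[t0 t1] := ht; have /andP[i1 i2] := inv_sqrt_le ht.
have heg := excess_gap hx ht.
apply: (@le_trans _ _ (c2_div_c1 - 2 * E * (238 / 235))).
  have : (x - t) * th <= (x - t) * (1 + 23 / 40 * t ^+ 2).
    apply: ler_wpM2l => //; have /andP[x1 _] := hx.
    by have /andP[a1 _] := @sqrt2_bounds R; clear -x1 a1 t1; lra.
  by rewrite /mid_weight -/th; move: heg; rewrite -/(excess x t) -/E; clear; lra.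
rewrite mulrBr mulr1 lerB// mulrC; apply: ler_wpM2l => //.
by rewrite mulr_ge0.
Qed.

End MidRange.

Section MidStepMain.
Context {R : realType}.
Implicit Types x t u : R.
Local Notation s2 := (Num.sqrt 2 : R).
Local Notation s3 := (Num.sqrt 3 : R).

Lemma mid_step_below x t : s2 <= x <= s3 -> 0 <= t <= 103 / 250 ->
  mid_bound ((x - t) / Num.sqrt (1 - t ^+ 2)) +
  mid_bound ((x + t) / Num.sqrt (1 - t ^+ 2)) <= 2 * mid_bound x.
Proof.
move=> hx /andP[t0 t1]; rewrite -step_at0.
have t1' : t < 1 by clear -t1; lra.
apply: (step_nincr (lexx 0) t0 t1' (@mid_bound_derive R) (@mid_bound_derive R)).
move=> u /andP[u0 ut]; apply: mid_cond_below => //.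
by rewrite u0 (le_trans ut).
Qed.

(** Let [v] be the value of [t] at which the second level crosses [sqrt 3].
    From [0] to [v] both levels use [mid_bound].  At [v] the two bounds agree at
    the second level, and from [v] to [t] that level uses
    [c2_div_c1 * Phibar]. *)
Lemma mid_step_above x t : s2 <= x <= s3 -> 0 <= t <= 103 / 250 ->
  s3 <= (x + t) / Num.sqrt (1 - t ^+ 2) ->
  mid_bound ((x - t) / Num.sqrt (1 - t ^+ 2)) +
  c2_div_c1 * Phibar ((x + t) / Num.sqrt (1 - t ^+ 2)) <= 2 * mid_bound x.
Proof.
move=> hx /andP[t0 t1] hB.
have t1' : t < 1 by clear -t1; lra.
pose B u := (x + u) / Num.sqrt (1 - u ^+ 2).
have cB : {within `[0, t], continuous B}.
  apply: continuous_in_subspaceT => u; rewrite inE/= in_itv/= => /andP[u0 ut].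
  have u1 : 0 < 1 - u ^+ 2 by clear -u0 ut t1'; nra.
  have [dB _] := rescaled_derive x u1.
  by apply: differentiable_continuous; exact/derivable1_diffP.
have B0 : B 0 = x by rewrite /B addr0 expr0n/= subr0 sqrtr1 divr1.
have [|v vt Bv] := IVT t0 cB (v := s3).
  rewrite B0; apply/andP; split.
    by rewrite ge_min; apply/orP; left; case/andP: hx.
  by rewrite le_max hB orbT.
move: vt; rewrite in_itv/= => /andP[v0 vt].
have v1 : v <= 103 / 250 by exact: le_trans vt t1.
apply: le_trans (mid_step_below hx (_ : 0 <= v <= _)); last by rewrite v0.
rewrite -/(B v) Bv mid_bound_sqrt3 -Bv /B.
have := step_nincr (x := x) v0 vt t1' (@mid_bound_derive R) (@c2_div_c1_Phibar_derive R).
apply => u /andP[vu ut]; apply: mid_cond_above => //.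
by rewrite (le_trans v0 vu) (le_trans ut).
Qed.

End MidStepMain.

(** * Tails of Rademacher sums *)
Section Rademacher.
Context {R : realType}.
Implicit Types (s : seq R) (a u y : R).

(** The probability that a sum of the entries of [s] with independent uniform
    random signs is at least [y], computed by conditioning on the first sign. *)
Fixpoint rtail s y : R :=
  if s is a :: s' then (rtail s' (y - a) + rtail s' (y + a)) / 2 else if y <= 0 then 1 else 0.

Definition sumsq s : R := \sum_(a <- s) a ^+ 2.

Lemma sumsq_ge0 s : 0 <= sumsq s.
Proof. by apply: sumr_ge0 => a _; exact: sqr_ge0. Qed.

Lemma rtail_cons_norm a s y :
  rtail (a :: s) y = (rtail s (y - `|a|) + rtail s (y + `|a|)) / 2.
Proof.
rewrite /=; case: (ger0P a) => // _.
by rewrite opprK addrC.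
Qed.

Lemma rtail_rem a s y : a \in s -> rtail s y = rtail (a :: rem a s) y.
Proof.
elim: s y => //= b s ih y; rewrite inE.
have [->//|ba /= sa] := eqVneq b a.
rewrite !ih//=; congr (_ / 2).
have -> : y - a - b = y - b - a by ring.
have -> : y + a - b = y - b + a by ring.
have -> : y - a + b = y + b - a by ring.
have -> : y + a + b = y + b + a by ring.
by field.
Qed.

Lemma sumsq_rem a s : a \in s -> sumsq s = a ^+ 2 + sumsq (rem a s).
Proof. by move=> sa; rewrite /sumsq (big_rem a sa). Qed.

Lemma rtail_le1 s y : rtail s y <= 1.
Proof.
elim: s y => [|a s ih] y /=; first by case: ifP.
by have := ih (y - a); have := ih (y + a); lra.
Qed.

(** With [S] the symmetric random sum, the left-hand side is
    [P (S >= y) + P (S <= - u)], and the two events are disjoint. *)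
Lemma rtail_pair_le1 s y u : 0 < y + u -> rtail s y + rtail s u <= 1.
Proof.
elim: s y u => [|a s ih] y u yu /=.
  by case: (leP y 0); case: (leP u 0); lra.
have := ih (y - a) (u + a); have := ih (y + a) (u - a).
have -> : y + a + (u - a) = y + u by ring.
have -> : y - a + (u + a) = y + u by ring.
by move=> /(_ yu) ? /(_ yu) ?; lra.
Qed.

Lemma rtail_le_half s y : 0 < y -> rtail s y <= 1 / 2.
Proof. by move=> y0; have := @rtail_pair_le1 s y y ltac:(lra); lra. Qed.

(** By symmetry of the sum [S] the left-hand side is [P (|S + u| >= y)], and
    [sumsq s + u ^ 2] is the second moment of [S + u]. *)
Lemma rtail_pair_chebyshev s y u : 0 < y ->
  rtail s (y - u) + rtail s (y + u) <= (sumsq s + u ^+ 2) / y ^+ 2.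
Proof.
move=> y0; rewrite ler_pdivlMr ?exprn_gt0//.
elim: s u => [|a s ih] u /=.
  rewrite /sumsq big_nil add0r.
  by case: (leP (y - u) 0); case: (leP (y + u) 0); nra.
have := ih (u + a); have := ih (u - a).
have -> : y - (u - a) = y - u + a by ring.
have -> : y + (u - a) = y + u - a by ring.
have -> : y - (u + a) = y - u - a by ring.
have -> : y + (u + a) = y + u + a by ring.
rewrite /sumsq big_cons -/(sumsq s).
move: (rtail s _) (rtail s _) (rtail s _) (rtail s _) => p q r v.
by move: (y ^+ 2) => Y; lra.
Qed.

Lemma rtail_chebyshev s y : 0 < y -> rtail s y <= sumsq s / (2 * y ^+ 2).
Proof.
move=> y0; have := @rtail_pair_chebyshev s y 0 y0.
rewrite subr0 addr0 expr0n/= addr0 => h.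
by rewrite invfM mulrA mulrAC; lra.
Qed.

Lemma rtail_eq0 s y : \sum_(a <- s) `|a| < y -> rtail s y = 0.
Proof.
elim: s y => [|a s ih] y.
  by rewrite big_nil /= => y0; rewrite leNgt y0.
rewrite big_cons rtail_cons_norm => h.
have a0 := normr_ge0 a.
by rewrite !ih; lra.
Qed.

(** Flipping a single sign lowers the sum by at least [2 * m], so only the
    pattern that makes every term nonnegative can reach the level. *)
Lemma rtail_le_single s y m : (forall a, a \in s -> m <= `|a|) ->
  \sum_(a <- s) `|a| - 2 * m < y -> rtail s y <= (2 ^+ size s)^-1.
Proof.
elim: s y => [|a s ih] y hm.
  by move=> _; rewrite expr0 invr1 rtail_le1.
rewrite big_cons rtail_cons_norm /= exprS => h.
have ma : m <= `|a| by apply: hm; rewrite mem_head.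
rewrite [rtail s (y + `|a|)]rtail_eq0 ?addr0; last by lra.
rewrite invfM [leRHS]mulrC ler_pM2r ?invr_gt0//.
by apply: ih => [b sb|]; [apply: hm; rewrite inE sb orbT|lra].
Qed.

(** [|a| <= (a^2 / l + l) / 2]; the best [l] would be the root mean square of
    the terms. *)
Lemma sum_norm_le s l : 0 < l ->
  \sum_(a <- s) `|a| <= (sumsq s / l + (size s)%:R * l) / 2.
Proof.
move=> l0; elim: s => [|a s ih].
  by rewrite /sumsq !big_nil mul0r mul0r addr0 mul0r.
rewrite /sumsq !big_cons -/(sumsq s) /= -natr1.
have : `|a| <= (a ^+ 2 / l + l) / 2.
  rewrite ler_pdivlMr// -(ler_pM2r l0) mulrDl mulfVK ?gt_eqF//.
  rewrite -(real_normK (num_real a)).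
  by have := sqr_ge0 (`|a| - l); move: `|a| => b; lra.
by rewrite [(_ + sumsq s) / l]mulrDl; lra.
Qed.

(** [6 * (103/250) ^ 2 > 1]. *)
Lemma size_le_of_large_terms s (sig : R) : 0 < sig -> sumsq s = sig ^+ 2 ->
  (forall a, a \in s -> 103 / 250 * sig <= `|a|) -> (size s <= 5)%N.
Proof.
move=> sig0 sE hs.
have : (size s)%:R * (103 / 250 * sig) ^+ 2 <= sumsq s.
  elim: s {sE} hs => [|a s ih] hs; first by rewrite mul0r sumsq_ge0.
  rewrite /sumsq big_cons -/(sumsq s) /= -natr1 mulrDl mul1r addrC lerD//.
    have h0 : 0 <= 103 / 250 * sig by lra.
    by rewrite -(real_normK (num_real a)) ler_sqr ?nnegrE// hs ?mem_head.
  by apply: ih => b sb; apply: hs; rewrite inE sb orbT.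
rewrite sE exprMn mulrA ger_pMl ?exprn_gt0//.
rewrite leqNgt; apply: contraTN => n5.
have : 6 <= (size s)%:R :> R by rewrite (ler_nat _ 6).
by rewrite -ltNge; move: (size s)%:R => n; lra.
Qed.

End Rademacher.

Section LargeTerms.
Context {R : realType}.
Implicit Types (s : seq R) (a u y : R).

(** Two terms have absolute values summing to at most [sqrt 2 * sig].  With
    three to five terms the sum is at most [sqrt 5 * sig], and
    [sqrt 5 - 2 * 103/250 < sqrt 2], so a single sign pattern out of at least
    eight can exceed the level. *)
Lemma rtail_le_eighth s y (sig : R) : 0 < sig -> sumsq s = sig ^+ 2 ->
  (forall a, a \in s -> 103 / 250 * sig <= `|a|) ->
  Num.sqrt 2 * sig < y -> rtail s y <= 1 / 8.
Proof.
move=> sig0 sE hs hy.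
have ss : (Num.sqrt 2 : R) ^+ 2 = 2 by rewrite sqr_sqrtr//; lra.
have /andP[b1 _] := @sqrt2_bounds R.
have r0 : 0 < Num.sqrt 2 :> R by clear -b1; lra.
have n5 := size_le_of_large_terms sig0 sE hs.
have [n2|n3] := leqP (size s) 2.
  rewrite rtail_eq0; first by rewrite divr_ge0.
  apply: le_lt_trans hy.
  apply: le_trans (sum_norm_le s (divr_gt0 sig0 r0)) _.
  have n2' : (size s)%:R <= 2 :> R by rewrite (ler_nat _ _ 2).
  rewrite (_ : sumsq s / _ = sig * Num.sqrt 2); last first.
    by rewrite sE invf_div; clear -sig0; field; rewrite gt_eqF.
  have h : (size s)%:R * (sig / Num.sqrt 2) <= 2 * (sig / Num.sqrt 2).
    by rewrite ler_wpM2r// divr_ge0 ?ltW.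
  have h2 : 2 * (sig / Num.sqrt 2) = sig * Num.sqrt 2.
    by rewrite -{1}ss; clear -r0; field; rewrite gt_eqF.
  rewrite h2 in h; rewrite [leRHS]mulrC; move: h; clear.
  by move: (_ * (sig / _)) => a; move: (sig * _) => b; lra.
apply: le_trans (rtail_le_single hs _) _; last first.
  have e8 : 1 / 8 = (2 ^+ 3)^-1 :> R by field.
  by rewrite e8 lef_pV2 ?posrE ?exprn_gt0// ler_eXn2l// ltr1n.
apply: le_lt_trans hy.
(* [9/20] and [41/29] approximate [1 / sqrt 5] and [sqrt 2]. *)
have l0 : 0 < 9 / 20 * sig by clear -sig0; lra.
have := sum_norm_le s l0.
have n5' : (size s)%:R <= 5 :> R by rewrite (ler_nat _ _ 5).
have : (size s)%:R * (9 / 20 * sig) <= 5 * (9 / 20 * sig).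
  exact: (ler_wpM2r (ltW l0) n5').
have e2 : sig ^+ 2 / (9 / 20 * sig) = 20 / 9 * sig.
  by clear -sig0; field; rewrite gt_eqF.
rewrite sE e2.
have : 41 / 29 * sig <= Num.sqrt 2 * sig.
  by rewrite ler_pM2r//; clear -b1; lra.
move: (Num.sqrt 2 * sig) (bigop _ _ _) ((size s)%:R * _) => u v w.
by clear -sig0; lra.
Qed.

End LargeTerms.

(** * Comparing the bounds with Chebyshev below sqrt 2 *)
Section NearSqrt2.
Context {R : realType}.
Implicit Types x t u v : R.
Local Notation s2 := (Num.sqrt 2 : R).
Local Notation s3 := (Num.sqrt 3 : R).

Lemma exp_taylor3 v : 0 <= v -> expR (- v) <= 1 - v + v ^+ 2 / 2.
Proof.
move=> /(exp_taylor_alternate 3).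
rewrite /exp_taylor !big_ord_recr big_ord0 /= !factorialsE.
lra.
Qed.

Lemma expR_ge_quadratic v : 0 <= v -> 1 + v + v ^+ 2 / 2 <= expR v.
Proof.
move=> v0; pose f u := 1 + u + u ^+ 2 / 2 - expR u.
have d u : is_derive u 1 f (1 + u - expR u).
  by rewrite /f; eapply is_derive_eq; [der|rewrite /=; field].
have : f v <= f 0.
  apply: (le_of_derive_le0 v0 (fun u _ => d u)) => u _.
  by rewrite subr_le0 expR_ge1Dx.
by rewrite /f expR0 expr0n/=; lra.
Qed.

Lemma phi_sqrt2_shift u : phi u = phi s2 * expR (1 - u ^+ 2 / 2).
Proof.
rewrite !phi_exp sqr_sqrtr; last by lra.
by rewrite divff ?pnatr_eq0// -[RHS]mulrA -expRD; congr (_ * expR _); ring.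
Qed.

Lemma c1_Phibar_sqrt2 : c1 R * Phibar s2 = 1 / 4.
Proof. by rewrite /c1; have := @Phibar_gt0 R s2 => h; field; rewrite gt_eqF. Qed.

Lemma c1_gt0 : 0 < c1 R.
Proof. by rewrite divr_gt0// mulr_gt0// Phibar_gt0. Qed.

Lemma c1_bounds : 54 / 17 <= c1 R <= 191 / 60.
Proof.
have F0 := @Phibar_gt0 R s2; have /andP[F1 F2] := @Phibar_sqrt2_bounds R.
rewrite /c1; move: (Phibar s2) F0 F1 F2 => F F0 F1 F2.
by rewrite ler_pdivlMr ?ler_pdivrMr ?mulr_gt0//; apply/andP; split; lra.
Qed.

Lemma c2E : c2 R = c1 R * c2_div_c1.
Proof. by []. Qed.

Lemma c1_phi_sqrt2_ge : 41 / 88 <= c1 R * phi s2.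
Proof.
have /andP[p1 _] := @phi_sqrt2_bounds R; have /andP[k1 _] := c1_bounds.
apply: (@le_trans _ _ (54 / 17 * (38 / 259))); first by lra.
by apply: ler_pM k1 p1; clear; lra.
Qed.

Lemma mid_bound_le x : x <= s3 -> mid_bound x <= c2_div_c1 * Phibar x.
Proof.
move=> x3; rewrite /mid_bound gerBl mulr_ge0//.
pose f u : R := s3 * (Phibar u - Phibar s3) - (phi u - phi s3).
have d u : is_derive u 1 f (- ((s3 - u) * phi u)).
  have ? := @Phibar_derive R u; have ? := @phi_derive R u.
  by rewrite /f; eapply is_derive_eq; [der|rewrite /=; ring].
have : f s3 <= f x.
  apply: (le_of_derive_le0 x3 (fun u _ => d u)) => u /andP[_ u3].
  by rewrite oppr_le0 mulr_ge0 ?subr_ge0// ltW ?phi_gt0.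
by rewrite {1}/f !subrr mulr0 subr0.
Qed.

Lemma mid_bound_anti x y : 0 <= x -> x <= y -> mid_bound y <= mid_bound x :> R.
Proof.
move=> x0 xy.
apply: (le_of_derive_le0 xy (fun u _ => mid_bound_derive u)) => u /andP[xu _].
rewrite oppr_le0 mulr_ge0 ?(ltW (phi_gt0 _))// /mid_weight.
have /andP[_ b2] := @sqrt3_bounds R; have /andP[g1 _] := @c2_div_c1_bounds R.
have u0 : 0 <= u by exact: le_trans xu.
by clear -b2 g1 u0; lra.
Qed.

(** [mid_bound] decreases, so the claim is needed at [sqrt 3] only, and it holds
    there because [Phibar (sqrt 3)] is more than half of [Phibar (sqrt 2)]. *)
Lemma mid_bound_ge_eighth x : 0 <= x <= s3 -> 1 / 8 <= c1 R * mid_bound x.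
Proof.
move=> /andP[x0 x3].
apply: le_trans (ler_wpM2l (ltW c1_gt0) (mid_bound_anti x0 x3)).
rewrite mid_bound_sqrt3.
have F0 := @Phibar_gt0 R s2; have /andP[_ F2] := @Phibar_sqrt2_bounds R.
have /andP[g1 _] := @c2_div_c1_bounds R; have p3 := @phi_sqrt3_ge R.
have /andP[b1 _] := @sqrt3_bounds R.
have q0 : 0 < s3 by clear -b1; lra.
have := Mills_lower q0.
have qq : s3 ^+ 2 = 3 by rewrite sqr_sqrtr//; lra.
have -> : s3 ^+ 4 = 9 by rewrite (exprM _ 2 2) qq; ring.
rewrite qq => F3.
have m1 : 6 / 13 <= s3 * (3 + 5) / (9 + 6 * 3 + 3).
  by rewrite ler_pdivlMr; clear -b1; lra.
have {F3} F3 : 1 / 25 <= Phibar s3.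
  apply: le_trans F3; apply: (@le_trans _ _ (11 / 125 * (6 / 13))); first by lra.
  by apply: ler_pM p3 m1; clear; lra.
have gF : 1 / 25 <= c2_div_c1 * Phibar s3.
  apply: le_trans F3 _; apply: ler_peMl; first exact: Phibar_ge0.
  by clear -g1; lra.
rewrite /c1 [1 / (4 * _)]div1r ler_pdivlMl ?mulr_gt0//.
by clear -gF F2; lra.
Qed.

(** The gain [(c2_div_c1 - 1) * Phibar (sqrt 2)] has to cover [7/50] times the
    integral of [(sqrt 3 - u) * phi u] from [sqrt 2] to [sqrt 3], which is
    [j (sqrt 2)] in the proof. *)
Lemma Phibar_sqrt2_le_mid_bound : Phibar s2 <= mid_bound s2.
Proof.
have a0 : 0 <= s2 by exact: sqrtr_ge0.
have aa : s2 ^+ 2 = 2 by rewrite sqr_sqrtr//; lra.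
have qq : s3 ^+ 2 = 3 by rewrite sqr_sqrtr//; lra.
have q0 : 0 <= s3 by exact: sqrtr_ge0.
have aq : s2 <= s3 by rewrite -ler_sqr ?nnegrE// aa qq; lra.
(* A primitive of [(s3 - u) * (7/4 - 3/8 * u^2)]; the second factor is
   [1 - 3/4 * v] with [v = u^2 / 2 - 1], an upper bound of [exp (- v)] on
   [0, 1/2]. *)
pose W u : R := s3 * (7 / 4 * u - u ^+ 3 / 8) - (7 / 8 * u ^+ 2 - 3 / 32 * u ^+ 4).
pose j u : R := s3 * (Phibar u - Phibar s3) - (phi u - phi s3).
have d u : is_derive u 1 (fun u => - (j u + phi s2 * W u))
    (- ((s3 - u) * (phi s2 * (7 / 4 - 3 / 8 * u ^+ 2) - phi u))).
  have ? := @Phibar_derive R u; have ? := @phi_derive R u.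
  by rewrite /j /W; eapply is_derive_eq; [der|rewrite /=; field].
have : - (j s3 + phi s2 * W s3) <= - (j s2 + phi s2 * W s2).
  apply: (le_of_derive_le0 aq (fun u _ => d u)) => u /andP[u2 u3].
  rewrite oppr_le0 mulr_ge0 ?subr_ge0// phi_sqrt2_shift.
  apply: ler_wpM2l; first exact: ltW (phi_gt0 _).
  have u0 : 0 <= u by exact: le_trans u2.
  have uu : 2 <= u ^+ 2 <= 3 by rewrite -aa -qq !ler_sqr ?nnegrE// u2 u3.
  rewrite (_ : 1 - u ^+ 2 / 2 = - (u ^+ 2 / 2 - 1)); last by ring.
  apply: le_trans (exp_taylor3 _) _.
    by clear -uu; move: uu => /andP[? ?]; lra.
  by move: (u ^+ 2) uu => U; clear => /andP[h1 h2]; nra.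
have j3 : j s3 = 0 by rewrite /j !subrr mulr0 subr0.
have s6 : 120 / 49 <= s2 * s3.
  by rewrite -ler_sqr ?nnegrE ?mulr_ge0// [leRHS]exprMn aa qq; clear; lra.
have WE : W s3 - W s2 = 119 / 32 - 3 / 2 * (s2 * s3).
  rewrite (_ : W s3 - W s2 = 7 / 4 * s3 ^+ 2 - (s3 ^+ 2) ^+ 2 / 8 - 7 / 8 * s3 ^+ 2
    + 3 / 32 * (s3 ^+ 2) ^+ 2 - 7 / 4 * (s2 * s3) + s2 ^+ 2 * (s2 * s3) / 8
    + 7 / 8 * s2 ^+ 2 - 3 / 32 * (s2 ^+ 2) ^+ 2); last by rewrite /W; field.
  by rewrite aa qq; field.
have W0 : W s3 - W s2 <= 5 / 110 by rewrite WE; clear -s6; lra.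
rewrite j3 add0r => h.
have p0 := phi_gt0 s2; have /andP[_ p2] := @phi_sqrt2_bounds R.
have hj : j s2 <= 26 / 177 * (5 / 110).
  apply: (@le_trans _ _ (phi s2 * (W s3 - W s2))).
    move: h; move: (phi s2) (W s3) (W s2) (j s2) => p w3 w2 j2; clear; lra.
  apply: (@le_trans _ _ (phi s2 * (5 / 110))); first by rewrite ler_wpM2l// ltW.
  by apply: ler_wpM2r.
rewrite -subr_ge0 /mid_bound -/(j s2).
have /andP[g1 _] := @c2_div_c1_bounds R; have /andP[F1 _] := @Phibar_sqrt2_bounds R.
have gF : 2 / 163 * (15 / 191) <= (c2_div_c1 - 1) * Phibar s2.
  by apply: ler_pM F1; clear -g1; lra.
rewrite (_ : _ - _ = (c2_div_c1 - 1) * Phibar s2 - 7 / 50 * j s2); last by ring.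
by move: (_ * Phibar s2) (j s2) gF hj; clear => a b; lra.
Qed.

(** In the variable [v = 1 - x^2 / 2], which vanishes at [sqrt 2], Chebyshev's
    bound [1 / (2 x^2)] is [1 / (4 (1 - v))], the density [phi x] is
    [phi (sqrt 2) * exp v], and [x = sqrt 2 * sqrt (1 - v)] is bounded by a
    Taylor polynomial.  All comparisons then become polynomial. *)
Lemma sqrt2_scale x : 1 <= x <= s2 ->
  let v := 1 - x ^+ 2 / 2 in
  0 <= v <= 1 / 2 /\ x <= 577 / 408 * (1 - v / 2 - v ^+ 2 / 8).
Proof.
move=> /andP[x1 x2] v.
have aa : s2 ^+ 2 = 2 by rewrite sqr_sqrtr//; lra.
have /andP[_ a2] := @sqrt2_bounds R.
have x0 : 0 <= x by clear -x1; lra.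
have xx1 : 1 <= x ^+ 2 by clear -x1; nra.
have xx2 : x ^+ 2 <= 2 by rewrite -aa ler_sqr ?nnegrE ?sqrtr_ge0.
have hv : 0 <= v <= 1 / 2.
  by rewrite /v; clear -xx1 xx2; apply/andP; split; lra.
split=> //.
have vE : x ^+ 2 = 2 - 2 * v by rewrite /v; field.
have m0 : 0 <= 1 - v / 2 - v ^+ 2 / 8.
  by clear -hv; move: hv => /andP[? ?]; nra.
pose b : R := 577 / 408; rewrite -/b.
have [b0 bb] : 0 <= b /\ 2 <= b ^+ 2 by rewrite /b; clear; split; lra.
clearbody b; rewrite -ler_sqr ?nnegrE//; last exact: mulr_ge0.
rewrite vE exprMn; clear -hv bb.
apply: (@le_trans _ _ (2 * (1 - v / 2 - v ^+ 2 / 8) ^+ 2)).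
  rewrite -subr_ge0 (_ : _ - _ = v ^+ 3 * (1 / 4 + v / 32)); last by field.
  by move: hv => /andP[v0 v1]; rewrite mulr_ge0 ?exprn_ge0//; lra.
by rewrite ler_wpM2r ?sqr_ge0.
Qed.

End NearSqrt2.

Section NearSqrt2Bounds.
Context {R : realType}.
Implicit Types x t u v : R.
Local Notation s2 := (Num.sqrt 2 : R).
Local Notation s3 := (Num.sqrt 3 : R).

(** The derivative inequality behind [chebyshev_le_Phibar]: the left-hand side
    comes from the cubic that dominates Chebyshev's bound, and the constants on
    the right are lower bounds for [c2_div_c1] and [c1 * phi (sqrt 2)]. *)
Lemma Phibar_weight_poly u w : 0 <= w <= 1 / 2 ->
  u <= 577 / 408 * (1 - w / 2 - w ^+ 2 / 8) ->
  u * (1 / 3 + w / 2 + 9 / 20 * w ^+ 2) <=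
  165 / 163 * (41 / 88) * (1 + w + w ^+ 2 / 2).
Proof.
move=> /andP[w0 w1] hu.
have w2 := exprn_ge0 2 w0; have w3 := exprn_ge0 3 w0.
have p0 : 0 <= 1 / 3 + w / 2 + 9 / 20 * w ^+ 2 by clear -w0 w2; lra.
apply: le_trans (ler_wpM2r p0 hu) _.
pose a : R := 165 / 163 * (41 / 88); rewrite -/a.
have a1 : 577 / 1224 <= a by rewrite /a; clear; lra.
clearbody a; rewrite -subr_ge0.
have -> : a * (1 + w + w ^+ 2 / 2) - 577 / 408 * (1 - w / 2 - w ^+ 2 / 8) *
    (1 / 3 + w / 2 + 9 / 20 * w ^+ 2) = (a - 577 / 1224) * (1 + w)
    + w ^+ 2 * (a / 2 - 577 / 408 * (19 / 120))
    + w ^+ 3 * (577 / 408 * (23 / 80) + 577 / 408 * (9 / 160) * w) by field.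
apply: addr_ge0; [apply: addr_ge0|]; apply: mulr_ge0.
- by clear -a1; lra.
- by clear -w0; lra.
- exact: w2.
- by clear -a1; lra.
- exact: w3.
- by clear -w0; lra.
Qed.

(** A cubic in [v = 1 - x^2 / 2] separates the two sides.  It dominates
    [1 / (4 (1 - v))] on [0, 1/2]; at [v = 0] its value [21/83] is below
    [c2_div_c1 / 4 = c2 * Phibar (sqrt 2)], and to the left of [sqrt 2] it grows
    more slowly than [c2 * Phibar]. *)
Lemma chebyshev_le_Phibar x : 1 <= x <= s2 -> 1 / (2 * x ^+ 2) <= c2 R * Phibar x.
Proof.
move=> /andP[x1 x2].
pose v u : R := 1 - u ^+ 2 / 2.
pose f u := c2 R * Phibar u - (21 / 83 + v u / 3 + v u ^+ 2 / 4 + 3 / 20 * v u ^+ 3).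
have d u : is_derive u 1 f (- (c2 R * phi u - u * (1 / 3 + v u / 2 + 9 / 20 * v u ^+ 2))).
  have ? := @Phibar_derive R u.
  by rewrite /f /v; eapply is_derive_eq; [der|rewrite /=; field].
have /andP[g1 _] := @c2_div_c1_bounds R.
have : f s2 <= f x.
  apply: (le_of_derive_le0 x2 (fun u _ => d u)) => u /andP[xu u2].
  have u1 : 1 <= u by exact: le_trans xu.
  have [] := @sqrt2_scale R u; first by rewrite u1.
  rewrite -/(v u) => /andP[v0 v1] hu.
  rewrite oppr_le0 subr_ge0.
  apply: (@le_trans _ _ (165 / 163 * (41 / 88) * (1 + v u + v u ^+ 2 / 2))); last first.
    rewrite phi_sqrt2_shift -/(v u) c2E.
    rewrite [leRHS](_ : _ = c2_div_c1 * (c1 R * phi s2) * expR (v u)); last by ring.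
    have v2 := sqr_ge0 (v u).
    apply: ler_pM; [by clear; lra|by clear -v0 v2; lra| |exact: expR_ge_quadratic].
    by apply: ler_pM g1 c1_phi_sqrt2_ge; clear; lra.
  by apply: Phibar_weight_poly => //; rewrite v0.
have v2 : v s2 = 0 by rewrite /v sqr_sqrtr ?divff ?subrr ?pnatr_eq0//; lra.
rewrite {1}/f v2 expr0n/= c2E mulrAC c1_Phibar_sqrt2 => h.
have : (21 / 83 + v x / 3 + v x ^+ 2 / 4 + 3 / 20 * v x ^+ 3) <= c2 R * Phibar x.
  by move: h; rewrite /f; move: (c2 R * _) (v x) => a b; clear -g1; lra.
apply: le_trans.
have [] := @sqrt2_scale R x; first by rewrite x1.
rewrite -/(v x) => /andP[v0 v1] _.
have -> : 2 * x ^+ 2 = 4 * (1 - v x) by rewrite /v; field.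
rewrite ler_pdivrMr; last by clear -v1; lra.
move: (v x) v0 v1; clear => w w0 w1.
have w2 : w ^+ 2 <= w / 2 by rewrite expr2 mulrC; nra.
have w3 : w ^+ 3 <= w / 4 by rewrite exprS; nra.
have w4 : w ^+ 4 <= w / 8 by rewrite exprS; nra.
by lra.
Qed.

End NearSqrt2Bounds.

Section NearSqrt2Mid.
Context {R : realType}.
Implicit Types x t u v : R.
Local Notation s2 := (Num.sqrt 2 : R).
Local Notation s3 := (Num.sqrt 3 : R).

(** The analogue of [Phibar_weight_poly] for [mid_bound], where
    [10/13 + 7/50 * u] bounds [mid_weight u] from below. *)
Lemma mid_weight_poly u w : 0 <= w <= 1 / 2 ->
  u <= 577 / 408 * (1 - w / 2 - w ^+ 2 / 8) ->
  u * (19 / 60 + 11 / 25 * w + w ^+ 2 / 3) <=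
  41 / 88 * (10 / 13 + 7 / 50 * u) * (1 + w + w ^+ 2 / 2).
Proof.
move=> /andP[w0 w1] hu.
have w2 := exprn_ge0 2 w0; have w3 := exprn_ge0 3 w0.
pose e : R := 7 / 50 * (41 / 88); pose T := 1 + w + w ^+ 2 / 2.
have [e1 e2] : 13 / 200 <= e /\ e <= 2 / 30 by rewrite /e; clear; split; lra.
have p0 : 0 <= 19 / 60 + 11 / 25 * w + w ^+ 2 / 3 - e * T.
  rewrite /T; have eT : e * (1 + w + w ^+ 2 / 2) <= 2 / 30 * (1 + w + w ^+ 2 / 2).
    by apply: ler_wpM2r => //; clear -w0 w2; lra.
  by move: eT; move: (e * _) => k; clear -w0 w2; lra.
pose a : R := 41 / 88 * (10 / 13); pose b : R := 577 / 408.
have ab0 : 0 <= a - b * (19 / 60 - e).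
  by rewrite /a /b; clear -e1; lra.
have ab1 : 0 <= a - b * (11 / 25 - 19 / 120 - e / 2).
  by rewrite /a /b; clear -e1; lra.
have ab2 : 0 <= a / 2 - b * (1 / 3 - 11 / 50 - 19 / 480 + e / 8).
  by rewrite /a /b; clear -e2; lra.
have b0 : 0 <= b by rewrite /b; clear; lra.
have -> : 41 / 88 * (10 / 13 + 7 / 50 * u) * T = a * T + u * (e * T).
  by rewrite /a /e; ring.
rewrite -lerBlDr -mulrBr.
apply: le_trans (ler_wpM2r p0 hu) _.
rewrite -/b -subr_ge0 /T; clearbody a b e.
have -> : a * (1 + w + w ^+ 2 / 2) - b * (1 - w / 2 - w ^+ 2 / 8) *
    (19 / 60 + 11 / 25 * w + w ^+ 2 / 3 - e * (1 + w + w ^+ 2 / 2)) =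
    a - b * (19 / 60 - e) + w * (a - b * (11 / 25 - 19 / 120 - e / 2))
    + w ^+ 2 * (a / 2 - b * (1 / 3 - 11 / 50 - 19 / 480 + e / 8))
    + w ^+ 3 * (b * (1 / 6 + 11 / 200 - e * 3 / 8) + b * ((1 / 24 - e / 16) * w)).
  by field.
apply: addr_ge0; [apply: addr_ge0; [apply: addr_ge0; first exact: ab0|]|].
- exact: mulr_ge0 w0 ab1.
- exact: mulr_ge0 w2 ab2.
- apply: mulr_ge0 w3 _; apply: addr_ge0; apply: mulr_ge0 b0 _.
    by clear -e2; lra.
  by apply: mulr_ge0 _ w0; clear -e2; lra.
Qed.

(** As in [chebyshev_le_Phibar], but with equality [1/4] allowed at [sqrt 2]:
    the separating cubic starts at [1/4].  It dominates Chebyshev's bound for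
    [v <= 13/32], which covers [x >= 109/100]. *)
Lemma chebyshev_le_mid_bound x : 109 / 100 <= x <= s2 ->
  1 / (2 * x ^+ 2) <= c1 R * mid_bound x.
Proof.
move=> /andP[x109 x2].
have x1 : 1 <= x by clear -x109; lra.
pose v u : R := 1 - u ^+ 2 / 2.
pose f u := c1 R * mid_bound u - (1 / 4 + 19 / 60 * v u + 11 / 50 * v u ^+ 2 + v u ^+ 3 / 9).
have d u : is_derive u 1 f (- (c1 R * (mid_weight u * phi u)
    - u * (19 / 60 + 11 / 25 * v u + v u ^+ 2 / 3))).
  have ? := @mid_bound_derive R u.
  by rewrite /f /v; eapply is_derive_eq; [der|rewrite /=; field].
have /andP[g1 _] := @c2_div_c1_bounds R.
have : f s2 <= f x.
  apply: (le_of_derive_le0 x2 (fun u _ => d u)) => u /andP[xu u2].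
  have u1 : 1 <= u by exact: le_trans xu.
  have [] := @sqrt2_scale R u; first by rewrite u1.
  rewrite -/(v u) => /andP[v0 v1] hu.
  rewrite oppr_le0 subr_ge0.
  have u0 : 0 <= u by clear -u1; lra.
  have v2 := sqr_ge0 (v u).
  apply: (@le_trans _ _ (41 / 88 * (10 / 13 + 7 / 50 * u) * (1 + v u + v u ^+ 2 / 2))); last first.
    rewrite phi_sqrt2_shift -/(v u).
    rewrite [leRHS](_ : _ = c1 R * phi s2 * mid_weight u * expR (v u)); last by ring.
    apply: ler_pM; [|by clear -v0 v2; lra| |exact: expR_ge_quadratic].
      by apply: mulr_ge0 => //; clear -u0; lra.
    apply: ler_pM; [by []|by clear -u0; lra|exact: c1_phi_sqrt2_ge|].
    have /andP[_ b2] := @sqrt3_bounds R.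
    by rewrite /mid_weight; clear -g1 b2; lra.
  by apply: mid_weight_poly => //; rewrite v0.
have v2 : v s2 = 0 by rewrite /v sqr_sqrtr ?divff ?subrr ?pnatr_eq0//; lra.
have m2 : 1 / 4 <= c1 R * mid_bound s2.
  by rewrite -c1_Phibar_sqrt2 ler_pM2l ?c1_gt0// Phibar_sqrt2_le_mid_bound.
rewrite {1}/f v2 expr0n/= => h.
have : 1 / 4 + 19 / 60 * v x + 11 / 50 * v x ^+ 2 + v x ^+ 3 / 9 <= c1 R * mid_bound x.
  by move: h m2; rewrite /f; move: (c1 R * _) (c1 R * _) (v x) => a b c; clear; lra.
apply: le_trans.
have [] := @sqrt2_scale R x; first by rewrite x1.
rewrite -/(v x) => /andP[v0 _] _.
have v1 : v x <= 13 / 32 by rewrite /v; clear -x109; nra.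
have -> : 2 * x ^+ 2 = 4 * (1 - v x) by rewrite /v; field.
rewrite ler_pdivrMr; last by clear -v1; lra.
move: (v x) v0 v1; clear => w w0 w1.
rewrite -subr_ge0 [leRHS](_ : _ = 4 * w * (1 / 15 - 29 / 300 * w
   - 49 / 450 * w ^+ 2 - w ^+ 3 / 9)); last by field.
apply: mulr_ge0; first lra.
have w2 : w ^+ 2 <= w * (13 / 32) by rewrite expr2; nra.
have w3 : w ^+ 3 <= w * (13 / 32) * (13 / 32) by rewrite exprS; nra.
by lra.
Qed.

End NearSqrt2Mid.

(** * The Gaussian bound for Rademacher sums *)
Section RademacherGauss.
Context {R : realType}.
Implicit Types (s : seq R) (a x y t : R).
Local Notation s2 := (Num.sqrt 2 : R).
Local Notation s3 := (Num.sqrt 3 : R).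
Local Notation norm s := (Num.sqrt (sumsq s)).

Lemma c2_ge2 : 2 <= c2 R.
Proof.
have /andP[k1 _] := @c1_bounds R; have /andP[g1 _] := @c2_div_c1_bounds R.
rewrite c2E; apply: (@le_trans _ _ (54 / 17 * (165 / 163))); first by clear; lra.
by apply: ler_pM k1 g1; clear; lra.
Qed.

Lemma c2_ge0 : 0 <= c2 R.
Proof. by apply: le_trans c2_ge2. Qed.

Lemma one_le_Phibar x : x <= 0 -> 1 <= c2 R * Phibar x.
Proof.
move=> x0; have h := Phibar_anti x0; rewrite Phibar0 in h.
apply: le_trans (ler_wpM2l c2_ge0 h).
by have c := c2_ge2; clear -c; lra.
Qed.

Lemma rtail_le_chebyshev s x : 0 < sumsq s -> 0 < x ->
  rtail s (x * norm s) <= 1 / (2 * x ^+ 2).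
Proof.
move=> s0 x0; have n0 : 0 < norm s by rewrite sqrtr_gt0.
apply: le_trans (rtail_chebyshev s (mulr_gt0 x0 n0)) _.
rewrite exprMn sqr_sqrtr ?sumsq_ge0//.
have -> : sumsq s / (2 * (x ^+ 2 * sumsq s)) = 1 / (2 * x ^+ 2) => //.
by clear -s0 x0; field; rewrite !gt_eqF.
Qed.

Lemma rtail_le_Phibar_low s x : 0 < sumsq s -> x <= s2 ->
  rtail s (x * norm s) <= c2 R * Phibar x.
Proof.
move=> s0 x2; have n0 : 0 < norm s by rewrite sqrtr_gt0.
have [x0|x0] := leP x 0.
  exact: le_trans (rtail_le1 _ _) (one_le_Phibar x0).
have [x1|x1] := leP x 1; last first.
  apply: le_trans (rtail_le_chebyshev s0 x0) _.
  by apply: chebyshev_le_Phibar; rewrite (ltW x1).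
apply: le_trans (rtail_le_half s (mulr_gt0 x0 n0)) _.
apply: le_trans (ler_wpM2l c2_ge0 (Phibar_anti x1)).
have /andP[a1 _] := @sqrt2_bounds R.
have := @chebyshev_le_Phibar R 1; rewrite expr1n mulr1; apply.
by rewrite lexx; clear -a1; lra.
Qed.

(** Removing [a] from the list multiplies its norm by [sqrt (1 - t^2)]. *)
Lemma rtail_cons_rescale a s x : 0 < sumsq s ->
  let t := `|a| / norm (a :: s) in
  [/\ 0 <= t < 1, `|a| = t * norm (a :: s) &
    rtail (a :: s) (x * norm (a :: s)) =
    (rtail s ((x - t) / Num.sqrt (1 - t ^+ 2) * norm s) +
     rtail s ((x + t) / Num.sqrt (1 - t ^+ 2) * norm s)) / 2].
Proof.
move=> s0 t.
have nE : norm (a :: s) ^+ 2 = a ^+ 2 + sumsq s.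
  by rewrite sqr_sqrtr ?sumsq_ge0// /sumsq big_cons.
have n0 : 0 < norm (a :: s).
  by rewrite sqrtr_gt0 /sumsq big_cons -/(sumsq s) ltr_wpDl ?sqr_ge0.
set n := norm (a :: s) in t nE n0 *.
have aE : `|a| = t * n by rewrite /t divfK// gt_eqF.
have t0 : 0 <= t by rewrite divr_ge0// ltW.
have t1 : t < 1.
  rewrite ltr_pdivrMr// mul1r -ltr_sqr ?nnegrE ?(ltW n0)//.
  by rewrite nE real_normK ?num_real// ltrDl.
have th0 : 0 < 1 - t ^+ 2.
  by rewrite subr_gt0 expr_lt1.
have nsE : norm s = Num.sqrt (1 - t ^+ 2) * n.
  apply/eqP; rewrite -(eqrXn2 (n := 2))// ?mulr_ge0 ?sqrtr_ge0 ?(ltW n0)//.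
  rewrite exprMn sqr_sqrtr ?sumsq_ge0// sqr_sqrtr ?(ltW th0)//.
  rewrite mulrBl mul1r -exprMn -aE nE.
  by rewrite real_normK ?num_real// addrC addKr.
split=> //; first by rewrite t0.
have thN : Num.sqrt (1 - t ^+ 2) != 0 by rewrite gt_eqF// sqrtr_gt0.
have e1 : (x - t) / Num.sqrt (1 - t ^+ 2) * norm s = x * n - `|a|.
  by rewrite nsE aE mulrA divfK// mulrBl.
have e2 : (x + t) / Num.sqrt (1 - t ^+ 2) * norm s = x * n + `|a|.
  by rewrite nsE aE mulrA divfK// mulrDl.
by rewrite rtail_cons_norm e1 e2.
Qed.

(** The lower level never leaves the range in which
    [chebyshev_le_mid_bound] is available. *)
Lemma rescaled_ge x t : s2 <= x -> 0 <= t <= 103 / 250 ->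
  109 / 100 <= (x - t) / Num.sqrt (1 - t ^+ 2).
Proof.
move=> x2 /andP[t0 t1]; have /andP[a1 _] := @sqrt2_bounds R.
have th0 : 0 < 1 - t ^+ 2 by clear -t0 t1; nra.
rewrite ler_pdivlMr ?sqrtr_gt0// -ler_sqr ?nnegrE ?mulr_ge0 ?sqrtr_ge0//; last first.
  by clear -x2 a1 t1; lra.
rewrite exprMn sqr_sqrtr ?(ltW th0)//.
apply: (@le_trans _ _ ((141 / 100 - t) ^+ 2)).
  by clear -t0 t1; nra.
by rewrite ler_sqr ?nnegrE; clear -x2 a1 t1; lra.
Qed.

Lemma rescaled_le x t : x <= s3 -> 0 <= t <= 103 / 250 -> t <= x ->
  (x - t) / Num.sqrt (1 - t ^+ 2) <= s3.
Proof.
move=> x3 /andP[t0 t1] tx; have /andP[b1 _] := @sqrt3_bounds R.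
have th0 : 0 < 1 - t ^+ 2 by clear -t0 t1; nra.
have q0 : 0 <= s3 by exact: sqrtr_ge0.
have qq : s3 ^+ 2 = 3 by rewrite sqr_sqrtr//; lra.
rewrite ler_pdivrMr ?sqrtr_gt0// -ler_sqr ?nnegrE ?mulr_ge0 ?sqrtr_ge0 ?subr_ge0//.
rewrite exprMn qq (sqr_sqrtr (ltW th0)).
apply: (@le_trans _ _ ((s3 - t) ^+ 2)).
  by rewrite ler_sqr ?nnegrE ?subr_ge0 ?lerD2r// (le_trans tx).
rewrite -subr_ge0.
rewrite (_ : _ - _ = 2 * t * (s3 - 2 * t) + (3 - s3 ^+ 2)); last by ring.
by rewrite qq subrr addr0 mulr_ge0 ?mulr_ge0//; clear -b1 t1; lra.
Qed.

(** Both bounds are proved together, since a step from the middle range can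
    lead to levels on either side of [sqrt 3].  Below [sqrt 2] both come from
    Chebyshev.  Between [sqrt 2] and [sqrt 3] a small coefficient is removed if
    there is one; above [sqrt 3] any coefficient may be removed. *)
Lemma rtail_le_gauss n s : (size s <= n)%N -> 0 < sumsq s -> forall x,
  rtail s (x * norm s) <= c2 R * Phibar x /\
  (109 / 100 <= x <= s3 -> rtail s (x * norm s) <= c1 R * mid_bound x).
Proof.
elim: n s => [|n ih] s.
  by rewrite leqn0 size_eq0 => /eqP ->; rewrite /sumsq big_nil ltxx.
move=> sn s0 x; have n0 : 0 < norm s by rewrite sqrtr_gt0.
have nn : sumsq s = norm s ^+ 2 by rewrite sqr_sqrtr// ltW.
have /andP[a1 a2] := @sqrt2_bounds R; have /andP[b1 b2] := @sqrt3_bounds R.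
have [x2|x2] := leP x s2.
  split; first exact: rtail_le_Phibar_low.
  move=> /andP[x1 _].
  apply: le_trans (rtail_le_chebyshev s0 (lt_le_trans _ x1)) _; first by clear; lra.
  by apply: chebyshev_le_mid_bound; rewrite x1.
have x14 : 14 / 10 <= x by clear -x2 a1; lra.
have [x3|x3] := leP x s3.
  suff h : rtail s (x * norm s) <= c1 R * mid_bound x.
    split=> //; apply: le_trans h _.
    by rewrite c2E -mulrA ler_wpM2l ?(ltW c1_gt0)// mid_bound_le.
  have [/hasP[a sa ha]|/hasPn hs] := boolP (has (fun a => `|a| <= 103 / 250 * norm s) s);
    last first.
    apply: (@le_trans _ _ (1 / 8)).
      apply: (rtail_le_eighth n0 nn); last by rewrite ltr_pM2r.
      by move=> a /hs; rewrite -ltNge => /ltW.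
    by apply: mid_bound_ge_eighth; rewrite x3 andbT; clear -x14; lra.
  have sE : sumsq s = sumsq (a :: rem a s) by rewrite (sumsq_rem sa) /sumsq big_cons.
  have s'0 : 0 < sumsq (rem a s).
    rewrite -(ltrD2l (a ^+ 2)) addr0 -(sumsq_rem sa) nn -(real_normK (num_real a)).
    rewrite ltr_sqr ?nnegrE ?(ltW n0)//.
    by apply: le_lt_trans ha _; rewrite gtr_pMl//; clear; lra.
  have [] := rtail_cons_rescale a x s'0; rewrite -sE -(rtail_rem _ sa).
  set t := _ / _ => /andP[t0 t1] aE ->.
  have ht : 0 <= t <= 103 / 250.
    by apply/andP; split; [exact: t0|rewrite -(ler_pM2r n0) -aE].
  have hx : s2 <= x <= s3 by rewrite (ltW x2).
  have tx : t <= x by case/andP: ht => _ ?; clear -x14 t1; lra.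
  have size' : (size (rem a s) <= n)%N.
    by rewrite size_rem//; case: (s) sn sa.
  have {}ih := ih _ size' s'0.
  set A := (x - t) / _; set B := (x + t) / _.
  have A1 : 109 / 100 <= A by apply: rescaled_ge => //; exact: ltW.
  have A2 : A <= s3 by apply: rescaled_le.
  have AB : A <= B.
    by rewrite ler_wpM2r ?invr_ge0 ?sqrtr_ge0// lerD2l; clear -t0; lra.
  have hA : rtail (rem a s) (A * norm (rem a s)) <= c1 R * mid_bound A.
    by apply: (ih A).2; rewrite A1.
  have c0 := @c1_gt0 R.
  have [B3|B3] := leP B s3.
    have hB : rtail (rem a s) (B * norm (rem a s)) <= c1 R * mid_bound B.
      by apply: (ih B).2; rewrite (le_trans A1 AB).
    have := ler_wpM2l (ltW c0) (mid_step_below hx ht); rewrite -/A -/B.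
    by move: hA hB; move: (rtail _ _) (rtail _ _) (c1 R) => p q c; clear; lra.
  have [hB _] := ih B.
  have := ler_wpM2l (ltW c0) (mid_step_above hx ht (ltW B3)); rewrite -/A -/B.
  by move: hA hB; rewrite c2E; move: (rtail _ _) (rtail _ _) (c1 R) => p q c; clear; lra.
split; last by move=> /andP[].
case: s sn s0 n0 nn => [|a s] sn s0 n0 nn; first by rewrite /sumsq big_nil ltxx in s0.
have [s'0|] := ltP 0 (sumsq s); last first.
  (* all the terms but [a] vanish *)
  move=> s'0; suff h : \sum_(b <- a :: s) `|b| < x * norm (a :: s).
    by rewrite (rtail_eq0 h); apply: mulr_ge0; [exact: c2_ge0|exact: Phibar_ge0].
  have z b : b \in s -> b = 0.
    move=> sb; apply/eqP; rewrite -sqrf_eq0 eq_le sqr_ge0 andbT.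
    apply: le_trans s'0; rewrite (sumsq_rem sb) lerDl sumsq_ge0.
    by [].
  have e : \sum_(b <- s) `|b| = 0.
    by rewrite big1_seq// => b /andP[_ /z ->]; rewrite normr0.
  have e2 : sumsq s = 0.
    by apply/eqP; rewrite eq_le s'0 sumsq_ge0.
  rewrite big_cons e addr0 -[ltLHS]mul1r.
  have -> : norm (a :: s) = `|a|.
    by rewrite /sumsq big_cons -/(sumsq s) e2 addr0 sqrtr_sqr.
  rewrite ltr_pM2r; first by clear -x3 b1; lra.
  rewrite normr_gt0; apply: contraTneq s0 => ->.
  by rewrite /sumsq big_cons -/(sumsq s) e2 addr0 expr0n ltxx.
have [] := rtail_cons_rescale a x s'0; set t := _ / _ => /andP[t0 t1] _ ->.
have {}ih := ih _ (sn : (size s <= n)%N) s'0.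
have [hA _] := ih ((x - t) / Num.sqrt (1 - t ^+ 2)).
have [hB _] := ih ((x + t) / Num.sqrt (1 - t ^+ 2)).
have t01 : 0 <= t < 1 by rewrite t0.
have := ler_wpM2l c2_ge0 (Phibar_step (ltW x3) t01).
move: hA hB; move: (rtail _ _) (rtail _ _) (c2 R) => p q c; clear; lra.
Qed.

End RademacherGauss.

(** * From orthant symmetry to Rademacher sums *)
Section SignPatterns.
Context {R : realType}.
Implicit Types (s e : seq R) (y : R).

Fixpoint sign_patterns (n : nat) : seq (seq R) :=
  if n is m.+1 then
    [seq 1 :: e | e <- sign_patterns m] ++ [seq -1 :: e | e <- sign_patterns m]
  else [:: [::]].

Definition dot e s : R := \sum_(p <- zip e s) p.1 * p.2.

Lemma dot_cons b e a s : dot (b :: e) (a :: s) = b * a + dot e s.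
Proof. by rewrite /dot /= big_cons. Qed.

Lemma sum_patterns_rtail s y :
  \sum_(e <- sign_patterns (size s)) (if y <= dot e s then 1 else 0) =
  2 ^+ size s * rtail s y.
Proof.
elim: s y => [|a s ih] y /=.
  by rewrite big_seq1 /dot /= big_nil expr0 mul1r.
rewrite big_cat !big_map /= exprS.
under eq_bigr do rewrite dot_cons mul1r -lerBlDl.
under [X in _ + X]eq_bigr do rewrite dot_cons mulN1r -lerBlDl opprK.
by rewrite !ih; field.
Qed.

Lemma size_sign_patterns n : size (sign_patterns n) = (2 ^ n)%N.
Proof.
by elim: n => //= n ih; rewrite size_cat !size_map ih expnS mul2n addnn.
Qed.

Lemma size_pattern n e : e \in sign_patterns n -> size e = n.
Proof.
elim: n e => [|n ih] e /=; first by rewrite inE => /eqP ->.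
by rewrite mem_cat => /orP[] /mapP[e' /ih <- ->].
Qed.

Lemma pattern_is_sign n e : e \in sign_patterns n ->
  is_sign (fun i : 'I_n => nth 1 e i).
Proof.
move=> he i.
have : all (fun b => (b == 1) || (b == -1)) e.
  elim: n e he {i} => [|n ih] e /=; first by rewrite inE => /eqP ->.
  by rewrite mem_cat => /orP[] /mapP[e' /ih h ->] /=; rewrite eqxx ?orbT h.
move=> /allP /(_ (nth 1 e i)); rewrite mem_nth ?(size_pattern he)//.
by move=> /(_ isT) /orP[] /eqP ->; [left|right].
Qed.

Lemma dot_nth n (e : seq R) (x : 'I_n -> R) : size e = n ->
  \sum_(i < n) nth 1 e i * x i = dot e [seq x i | i <- enum 'I_n].
Proof.
elim: n e x => [|n ih] [|b e] x //=.
  by rewrite big_ord0 (size0nil (size_enum_ord 0)) /dot big_nil.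
move=> [se]; rewrite big_ord_recl /= enum_ordSl /= dot_cons -map_comp -ih//.
Qed.

Lemma sumsq_enum n (x : 'I_n -> R) :
  sumsq [seq x i | i <- enum 'I_n] = \sum_(i < n) x i ^+ 2.
Proof. by rewrite /sumsq big_map big_enum. Qed.

End SignPatterns.

Section SelfNormalized.
Local Open Scope ereal_scope.
Context {R : realType}.

(** The ratio is discontinuous where [Q] vanishes, so the event is written
    without division: where [Q] is zero, the ratio is zero. *)
Lemma measurable_ratio_ge d (T : measurableType d) (S Q : T -> R) (x : R) :
  measurable_fun setT S -> measurable_fun setT Q -> (forall t, 0 <= Q t)%R ->
  measurable [set t | (x <= S t / Num.sqrt (Q t))%R].
Proof.
move=> mS mQ Q0.
rewrite (_ : [set _ | _] = (fun t => if (0 < Q t)%R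
   then (x * Num.sqrt (Q t) <= S t)%R else (x <= 0)%R) @^-1` [set true]).
  rewrite -[X in measurable X]setTI; apply: measurable_fun_ifT => //.
  - exact: measurable_fun_ltr.
  - apply: measurable_fun_ler => //; apply: measurable_funM => //.
    apply: measurableT_comp => //; apply: continuous_measurable_fun.
    exact: sqrt_continuous.
apply/seteqP; split => t /=; case: ltP (Q0 t) => [q0 _|q0 q1].
- by rewrite ler_pdivlMr ?sqrtr_gt0// => ->.
- by rewrite (le_anti (introT andP (conj q0 q1))) sqrtr0 invr0 mulr0 => ->.
- by rewrite ler_pdivlMr ?sqrtr_gt0.
- by rewrite (le_anti (introT andP (conj q0 q1))) sqrtr0 invr0 mulr0.
Qed.

(** Flipping the signs of the [X i] does not change the probability of the
    event, so it equals the average over all sign patterns, and pointwise that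
    average is a Rademacher tail with coefficients [X i t]. *)
Lemma self_normalized_le d (T : measurableType d) (P : probability T R) (n : nat)
    (X : 'I_n -> {RV P >-> R}) (x : R) : orthant_symmetric X ->
  P [set t | (x <= self_normalized_sum X t)%R] <= (c2 R * Phibar x)%:E.
Proof.
move=> symX.
pose Q (t : T) : R := (\sum_(i < n) X i t ^+ 2)%R.
have Q0 t : (0 <= Q t)%R by apply: sumr_ge0 => i _; exact: sqr_ge0.
have mX i : measurable_fun setT (X i) by exact: measurable_funPT.
have mQ : measurable_fun setT Q.
  by apply: measurable_sum => i; exact: measurable_funX.
pose S (e : seq R) (t : T) : R := (\sum_(i < n) nth 1 e i * X i t)%R.
pose E e := [set t | (x <= S e t / Num.sqrt (Q t))%R].
have mE e : measurable (E e).
  apply: measurable_ratio_ge => //; apply: measurable_sum => i.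
  exact: measurable_funM.
pose A := [set v : n.-tuple R | (x <= (\sum_(i < n) tnth v i) /
  Num.sqrt (\sum_(i < n) tnth v i ^+ 2))%R].
have mA : measurable A.
  apply: measurable_ratio_ge.
  - by apply: measurable_sum => i; exact: measurable_tnth.
  - by apply: measurable_sum => i; apply: measurable_funX; exact: measurable_tnth.
  - by move=> v; apply: sumr_ge0 => i _; exact: sqr_ge0.
have EA (delta : 'I_n -> R) : is_sign delta ->
    pushforward P (signed_vector X delta) A =
    P [set t | (x <= (\sum_(i < n) delta i * X i t) / Num.sqrt (Q t))%R].
  move=> sd; rewrite /pushforward; congr (P _); apply/funext => t.
  rewrite /preimage /A /=; congr (is_true (x <= _ / Num.sqrt _)%R).
    by apply: eq_bigr => i _; rewrite tnth_mktuple.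
  apply: eq_bigr => i _; rewrite tnth_mktuple exprMn.
  by case: (sd i) => ->; rewrite ?sqrrN expr1n mul1r.
have one_sign : is_sign (fun _ : 'I_n => 1%R : R) by move=> i; left.
have PE e : e \in sign_patterns n ->
    P (E e) = P [set t | (x <= self_normalized_sum X t)%R].
  move=> he; rewrite -(EA _ (pattern_is_sign he)).
  rewrite (symX _ _ (pattern_is_sign he) one_sign A mA) EA//.
  congr (P _); apply/seteqP; split => t /=; rewrite /self_normalized_sum -/(Q t);
    by under eq_bigr do rewrite mul1r.
have bnd0 : (0 <= 2 ^+ n * (c2 R * Phibar x))%R.
  apply: mulr_ge0; first by rewrite exprn_ge0.
  by apply: mulr_ge0; [exact: c2_ge0|exact: Phibar_ge0].
have pointwise t : (\sum_(e <- sign_patterns n) \1_(E e) t <=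
    2 ^+ n * (c2 R * Phibar x))%R.
  have indE e : \1_(E e) t = (if x <= S e t / Num.sqrt (Q t) then 1 else 0)%R :> R.
    rewrite indicE; case: ifP => h; first by rewrite mem_set.
    by rewrite memNset// /E /= h.
  under eq_bigr do rewrite indE.
  have [q0|q0] := ltP 0%R (Q t).
    pose s := [seq X i t | i <- enum 'I_n].
    have ss : size s = n by rewrite size_map size_enum_ord.
    have sQ : sumsq s = Q t by rewrite sumsq_enum.
    rewrite (eq_big_seq (fun e => if x * Num.sqrt (Q t) <= dot e s then 1 else 0)%R);
      last first.
      move=> e he; rewrite ler_pdivlMr ?sqrtr_gt0//.
      by rewrite -dot_nth// (size_pattern he).
    rewrite -{1}ss sum_patterns_rtail ss ler_wpM2l ?exprn_ge0// -sQ.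
    by apply: (rtail_le_gauss (leqnn _) _ _).1; rewrite sQ.
  have -> : Q t = 0%R by apply/le_anti; rewrite q0 Q0.
  rewrite sqrtr0 invr0.
  under eq_bigr do rewrite mulr0.
  rewrite big_const_seq count_predT size_sign_patterns iter_addr_0.
  case: ifP => x0; last first.
    by rewrite mul0rn.
  by rewrite natrX ler_peMr ?exprn_ge0// one_le_Phibar.
have : \int[P]_t (\sum_(e <- sign_patterns n) (\1_(E e) t)%:E) <=
    \int[P]_t (2 ^+ n * (c2 R * Phibar x))%:E.
  apply: ge0_le_integral => //.
  - by move=> t _; apply: sume_ge0 => e _; rewrite lee_fin.
  - apply: emeasurable_sum => e; apply/measurable_EFinP.
    exact: measurable_indic.
  - by move=> t _; rewrite sumEFin lee_fin.
rewrite integral_cst//= probability_setT mule1.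
rewrite ge0_integral_sum//; last first.
  by move=> e; apply/measurable_EFinP; exact: measurable_indic.
under eq_bigr do rewrite integral_indic// setIT.
rewrite big_seq (eq_bigr _ PE) -big_seq.
set p := P _; have pE : p = (fine p)%:E.
  rewrite fineK// fin_num_measure//; apply: measurable_ratio_ge => //.
  exact: measurable_sum.
rewrite pE sumEFin !lee_fin big_const_seq count_predT size_sign_patterns.
by rewrite iter_addr_0 -[(fine p *+ _)%R]mulr_natl natrX ler_pM2l ?exprn_gt0.
Qed.

End SelfNormalized.

(** * The lower bound and the least constant *)
Section TwoCoins.
Context {R : realType}.

Definition fair_coin : probability bool R := bernoulli_prob (2^-1 : R).

Definition two_coins : probability (bool * bool)%type R :=
  (fair_coin \x fair_coin)%E.

Lemma fair_coinE (A : set bool) :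
  fair_coin A = (2^-1 * ((true \in A)%:R + (false \in A)%:R))%:E.
Proof.
rewrite (_ : fair_coin A = bernoulli_prob 2^-1 A)//.
rewrite bernoulli_probE; last by apply/andP; split; lra.
by rewrite !diracE -!EFinM -EFinD /unstable.onem; congr _%:E; field.
Qed.

Lemma two_coinsE (A : set (bool * bool)) : two_coins A =
  (4^-1 * (((true, true) \in A)%:R + ((true, false) \in A)%:R
         + ((false, true) \in A)%:R + ((false, false) \in A)%:R))%:E.
Proof.
rewrite (_ : two_coins A = \int[bernoulli_prob 2^-1]_x fair_coin (xsection A x))%E//.
rewrite integral_bernoulli_prob; last 2 first.
- by apply/andP; split; lra.
- by move=> b; rewrite /= measure_ge0.
rewrite /= !fair_coinE !mem_xsection -!EFinM -EFinD /unstable.onem.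
by congr _%:E; field.
Qed.

Definition coin_sign (i : 'I_2) (t : bool * bool) : R :=
  if (if i == ord0 then t.1 else t.2) then 1 else -1.

Lemma measurable_coin_sign i : measurable_fun setT (coin_sign i).
Proof.
rewrite /coin_sign; apply: measurable_fun_ifT => //.
by case: (i == ord0) => /=; [exact: measurable_fst|exact: measurable_snd].
Qed.

HB.instance Definition _ i :=
  isMeasurableFun.Build _ _ _ _ (coin_sign i) (@measurable_coin_sign i).

Definition coin_rv (i : 'I_2) : {RV two_coins >-> R} := coin_sign i.

(** A vector of signs only permutes the four equally likely values. *)
Lemma coin_rv_symmetric : orthant_symmetric coin_rv.
Proof.
pose w (a b : R) : 2.-tuple R := [tuple if i == ord0 then a else b | i < 2].
suff sym delta : is_sign delta -> forall A : set (2.-tuple R),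
    pushforward two_coins (signed_vector coin_rv delta) A =
    (4^-1 * ((w 1 1 \in A)%:R + (w 1 (-1) \in A)%:R
       + (w (-1) 1 \in A)%:R + (w (-1) (-1) \in A)%:R))%:E.
  by move=> delta delta' s s' A _; rewrite !sym.
move=> sd A.
have sv t : signed_vector coin_rv delta t =
    w (delta ord0 * (if t.1 then 1 else -1)) (delta ord_max * (if t.2 then 1 else -1)).
  apply: eq_from_tnth => i; rewrite !tnth_mktuple /= /coin_sign.
  by case: i => -[|[|//]] h /=; congr (delta _ * _); exact: val_inj.
have mem t : (t \in signed_vector coin_rv delta @^-1` A) =
    (signed_vector coin_rv delta t \in A).
  by apply/idP/idP; rewrite !inE.
rewrite /pushforward two_coinsE !mem !sv /=; congr _%:E.
case: (sd ord0) => ->; case: (sd ord_max) => ->;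
  by rewrite ?mulr1 ?mulN1r ?opprK ?mul1r //; ring.
Qed.

(** At the level [sqrt 2] the outcome with both signs positive already has
    probability [1/4]. *)
Lemma c1_lower_bound : lbound (tail_constants R) (c1 R).
Proof.
move=> c /(_ _ _ two_coins 2%N coin_rv isT coin_rv_symmetric (Num.sqrt 2)).
rewrite two_coinsE lee_fin => h.
rewrite /c1 ler_pdivrMr; last by rewrite mulr_gt0// Phibar_gt0.
have m : (true, true) \in [set t | Num.sqrt 2 <= self_normalized_sum coin_rv t].
  rewrite inE /= /self_normalized_sum !big_ord_recr !big_ord0 /= /coin_sign /=.
  rewrite !add0r !expr1n (_ : 1 + 1 = 2 :> R)//.
  by rewrite -{2}(@sqr_sqrtr R 2)// expr2 mulfK// gt_eqF// sqrtr_gt0.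
rewrite m in h.
have : 4^-1 * (1 : R) <= c * Phibar (Num.sqrt 2).
  by apply: le_trans h; rewrite ler_pM2l// -!addrA lerDl !addr_ge0.
by lra.
Qed.

End TwoCoins.

Lemma c2_tail_constant (R : realType) : tail_constants R (c2 R).
Proof. by move=> d T P n X n1 symX x; exact: self_normalized_le. Qed.

Lemma tail_constants_has_inf (R : realType) : has_inf (tail_constants R).
Proof.
by split; [exists (c2 R); exact: c2_tail_constant|exists (c1 R); exact: c1_lower_bound].
Qed.

(** Each instance bounds the constants from below by a ratio with denominator
    [Phibar x > 0], and such bounds pass to the infimum. *)
Lemma inf_tail_constant (R : realType) : tail_constants R (inf (tail_constants R)).
Proof.
move=> d T P n X n1 symX x.
set p := P _.
have pE : p = (fine p)%:E.
  rewrite fineK// ge0_fin_numE ?measure_ge0//.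
  by apply: le_lt_trans (ltry (c2 R * Phibar x)); exact: c2_tail_constant.
rewrite pE lee_fin -ler_pdivrMr ?Phibar_gt0//.
apply: lb_le_inf; first by have [] := tail_constants_has_inf R.
move=> c hc; rewrite ler_pdivrMr ?Phibar_gt0// -lee_fin -pE.
exact: hc.
Qed.

Unset Implicit Arguments.

Theorem corollary1 (R : realType) :
  (exists c : R,
     [/\ tail_constants R c,
         lbound (tail_constants R) c
       & c1 R <= c <= c2 R]) /\
  [/\ `|c1 R - 318 / 100| <= 5 / 1000,
      `|c2 R - 322 / 100| <= 5 / 1000
    & `|c2 R / c1 R - 101 / 100| <= 5 / 1000].
Proof.
have [ne lb] := tail_constants_has_inf R.
split.
  exists (inf (tail_constants R)); split.
  - exact: inf_tail_constant.
  - by move=> c hc; exact: ge_inf.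
  - apply/andP; split; first exact: lb_le_inf ne (@c1_lower_bound R).
    by apply: ge_inf => //; exact: c2_tail_constant.
have /andP[k1 k2] := @c1_bounds R; have /andP[g1 g2] := @c2_div_c1_bounds R.
have c10 := @c1_gt0 R.
have e1 : 54 / 17 * (165 / 163) <= c2 R by rewrite c2E; apply: ler_pM k1 g1; clear; lra.
have e2 : c2 R <= 191 / 60 * (238 / 235).
  by rewrite c2E; apply: ler_pM k2 g2; [exact: ltW|clear -g1; lra].
have e3 : c2 R / c1 R = c2_div_c1 by rewrite c2E mulrC mulKf// gt_eqF.
rewrite e3 !ler_norml; split.
- by clear -k1 k2; apply/andP; split; lra.
- by clear -e1 e2; apply/andP; split; lra.
- by clear -g1 g2; apply/andP; split; lra.
Qed.
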